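(* Let $n\ge 2$, $1\le k\le n$, let $\mathbb{B}_n\subset\mathbb{C}^n$ be the open Euclidean unit ball and $A:=\{z\in\mathbb{B}_n:z_1\cdots z_k=0\}$. Let $z\in\mathbb{B}_n$ satisfy $|z_1|\le\dots\le|z_k|$ and let $$d:=\max\Big\{s\in\{1,\dots,k\}:s|z_s|^2+\sum_{j=s+1}^n|z_j|^2\le 1\Big\}.$$ Then $$m_{\mathbb{B}_n}(A,z)=g_{\mathbb{B}_n}(A,z)=\Big(\frac{d}{1-\sum_{j=d+1}^n|z_j|^2}\Big)^{\frac d2}\prod_{j=1}^d|z_j|.$$
   Context: $\mathbb{D}\subset\mathbb{C}$ is the open unit disc. For a domain $G\subset\mathbb{C}^n$ and $A\subset G$, the generalized Green function is $g_G(A,z):=\sup u(z)$, the supremum over all $u:G\to[0,1)$ such that $\log u$ is plurisubharmonic on $G$ (with $\log 0=-\infty$) and for every $a\in A$ there is a constant $C=C(u,a)>0$ with $u(w)\le C\|w-a\|$ for all $w\in G$. The generalized Möbius function is $m_G(A,z):=\sup\{|f(z)|: f:G\to\mathbb{D}\text{ holomorphic},\ f|_A\equiv 0\}$. *)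

(* Defs.v *)
From HB Require Import structures.
From mathcomp Require Import all_boot all_order all_algebra complex.
From mathcomp Require Import all_classical all_reals all_analysis.

Set Implicit Arguments.
Unset Strict Implicit.
Unset Printing Implicit Defensive.

Import Order.TTheory GRing.Theory Num.Theory.
Import numFieldNormedType.Exports.

Local Open Scope ring_scope.
Local Open Scope classical_set_scope.

(* The library puts the topology and the normed module structure of a
   numeric field on its regular algebra, hence [R[i]^o] for the complex field.
   The induced topology on row vectors is the product topology. *)
Notation "''Cn[' R ]_ n" := 'rV[R[i]^o]_n
  (at level 8, n at level 2, format "''Cn[' R ]_ n") : type_scope.

(* The norm [`|w|] of [w : R[i]] lives in [R[i]]; the modulus is real-valued. *)
Definition modulus (R : realType) (w : R[i]) : R := ComplexField.Normc.normc w.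

(* Euclidean norm; the norm carried by ['rV] in the library is the sup norm. *)
Definition enorm (R : realType) (n : nat) (z : 'Cn[R]_n) : R :=
  Num.sqrt (\sum_(j < n) modulus (z 0 j) ^+ 2).

Definition unit_ball (R : realType) (n : nat) : set 'Cn[R]_n :=
  [set z | enorm z < 1].

(* Complex Frechet differentiability at every point; meant for open [G]. *)
Definition holomorphic_on (R : realType) (n : nat) (G : set 'Cn[R]_n)
    (f : 'Cn[R]_n -> R[i]^o) : Prop :=
  forall z, G z -> differentiable f z.

Definition usc_on (R : realType) (T : topologicalType) (U : set T)
    (v : T -> \bar R) : Prop :=
  forall x, U x -> forall a : R, (v x < a%:E)%E ->
    \forall y \near x, U y -> (v y < a%:E)%E.

Definition circle_point (R : realType) (a : R[i]) (r t : R) : R[i]^o :=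
  a + (r * cos t +i* (r * sin t))%C.

(* Upper semicontinuity, values in [-oo, +oo[, and the sub-mean value
   inequality on every closed disc contained in [U]; [v = -oo] is allowed. *)
Definition subharmonic_on (R : realType) (U : set R[i]^o)
    (v : R[i]^o -> \bar R) : Prop :=
  [/\ forall a, U a -> (v a < +oo)%E,
      usc_on U v
    & forall (a : R[i]^o) (r : R), 0 < r ->
        (forall w : R[i]^o, modulus (w - a) <= r -> U w) ->
        (v a <= ((2 * pi)^-1)%:E *
          \int[lebesgue_measure]_(t in `[0%R, (2 * pi)%R])
             v (circle_point a r t))%E].

Definition plurisubharmonic_on (R : realType) (n : nat) (G : set 'Cn[R]_n)
    (v : 'Cn[R]_n -> \bar R) : Prop :=
  [/\ forall z, G z -> (v z < +oo)%E,
      usc_on G v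
    & forall z X : 'Cn[R]_n, G z ->
        subharmonic_on [set l : R[i]^o | G (z + l *: X)]
                       (fun l : R[i]^o => v (z + l *: X))].

(* [lne 0 = -oo]. *)
Definition green_competitor (R : realType) (n : nat) (G A : set 'Cn[R]_n)
    (u : 'Cn[R]_n -> R) : Prop :=
  [/\ forall w, G w -> 0 <= u w < 1,
      plurisubharmonic_on G (fun w => lne (u w)%:E)
    & forall a, A a -> exists2 C : R, 0 < C &
        forall w, G w -> u w <= C * enorm (w - a)].

Definition green (R : realType) (n : nat) (G A : set 'Cn[R]_n)
    (z : 'Cn[R]_n) : R :=
  sup [set u z | u in [set u : 'Cn[R]_n -> R | green_competitor G A u]].

Definition mobius_competitor (R : realType) (n : nat) (G A : set 'Cn[R]_n)
    (f : 'Cn[R]_n -> R[i]^o) : Prop :=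
  [/\ forall w, G w -> modulus (f w) < 1,
      holomorphic_on G f
    & forall a, A a -> f a = 0].

Definition mobius (R : realType) (n : nat) (G A : set 'Cn[R]_n)
    (z : 'Cn[R]_n) : R :=
  sup [set modulus (f z) | f in
        [set f : 'Cn[R]_n -> R[i]^o | mobius_competitor G A f]].

(* Coordinates are indexed from 0: [z 0 i] is the coordinate z_(i+1). *)
Definition ball_cross (R : realType) (n k : nat) : set 'Cn[R]_n :=
  [set z | unit_ball z /\ \prod_(i < n | (i < k)%N) z 0 i = 0].

(* The index s is [i.+1], so z_s is [z 0 i] and j > s becomes [(i < j)%N]. *)
Definition cross_index (R : realType) (n k : nat) (z : 'Cn[R]_n) : nat :=
  \max_(i < n | (i < k)%N &&
      (i.+1%:R * modulus (z 0 i) ^+ 2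
         + \sum_(j < n | (i < j)%N) modulus (z 0 j) ^+ 2 <= 1)) i.+1.

(* Main.v *)
Require Import Defs.
From mathcomp Require Import all_boot all_order all_algebra complex.
From mathcomp Require Import all_classical all_reals all_analysis.
From mathcomp Require Import measurable_realfun ring lra.
Set Implicit Arguments.
Unset Strict Implicit.
Unset Printing Implicit Defensive.
Import Order.TTheory GRing.Theory Num.Theory.
Import numFieldNormedType.Exports.
Local Open Scope ring_scope.
Local Open Scope classical_set_scope.

(** Let [d] be the index of the statement, [b = tail_gap d z] the number
    [1 - \sum_(j >= d) |z_j|^2], [rho ^+ 2 = b / d], and let [F] be the product
    of the [|z_j| / rho] over [j < d], which is the right-hand side. Both
    extremal functions are shown to be [F]: it bounds all competitors for both,
    and a sequence of polynomials competes for both with values at [z] tending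
    to [F].

    Upper bound. The points whose first [d] coordinates have modulus less than
    [rho], and whose other coordinates are those of [z], lie in the ball. On a
    coordinate disc of this polydisc a competitor satisfies a Schwarz lemma,
    since it vanishes, at least linearly, where the coordinate does. Applied to
    one coordinate after the other this yields the factors [|z_j| / rho]
    ([coord_schwarz_bound]). The definition of [d] gives [|z_j| <= rho] for
    [j < d] ([cross_index_below]).

    The Schwarz lemma is needed for log-subharmonic functions, for the Green
    function ([log_subharmonic_schwarz]), and for holomorphic functions, for
    the Moebius function ([holomorphic_schwarz]). Both follow from
    [max_principle]. The holomorphic case uses the mean value property
    [mean_value] of functions that are only assumed differentiable; it is the
    theorem of Goursat in logarithmic polar coordinates ([goursat]). The other
    case uses that [ln |w|] has the mean [ln |a|] over circles around [a] that
    do not enclose 0. This is computed by doubling the angle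
    ([log_cos_int_double]): since [|1 - r u| |1 + r u| = |1 - r^2 u^2|], the
    integral [I r] of [ln |1 - r u|] over the unit circle satisfies
    [2 I(r) = I(r^2)], hence vanishes for [r < 1].

    Lower bound. The function
    [C * \prod_(j < k) w_j * exp (\sum_(j >= d) g_j conj(z_j) w_j)] has modulus
    less than 1 on the ball and modulus [F] at [z] for suitable constants. By
    the arithmetic-geometric mean inequality in the first [d] coordinates, one
    needs a bound of
    [(d / 2) ln (1 - \sum_(j >= d) t_j^2) + \sum_(d <= j < k) ln t_j] by an
    affine function of the [t_j = |w_j|], and the tangent hyperplane at
    [t_j = |z_j|] is one, by concavity. Its slopes are [- g_j |z_j|], and
    [g_j >= 0] holds because [d |z_j|^2 > b] for [d <= j < k]
    ([cross_index_above]); this sign allows replacing [t_j] by the real part of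
    a linear form ([envelope_le]). With [(1 + L / N)^N] in place of [exp L] the
    function is a product of affine forms, so that the logarithm of its modulus
    is plurisubharmonic as soon as [ln |a + b l|] is subharmonic in one variable
    ([log_affine_submean]), again by doubling the angle. *)

(** * Integrals of continuous functions over a segment *)

Section integral.
Context {R : realType}.
Notation mu := (@lebesgue_measure R).
Implicit Types (f g : R -> R) (a b c : R).

Definition itv_int f a b : R := \int[mu]_(x in `[a, b]) f x.

Definition cont_on f a b := forall x, a <= x <= b -> {for x, continuous f}.

Lemma cont_on_integrable f a b :
  cont_on f a b -> mu.-integrable `[a, b] (EFin \o f).
Proof.
move=> cf; apply: continuous_compact_integrable; first exact: segment_compact.
by apply: continuous_in_subspaceT => x /set_mem /=; rewrite in_itv /=; exact: cf.
Qed.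

Lemma itv_int_split f a c b : a <= c <= b -> cont_on f a b ->
  itv_int f a b = itv_int f a c + itv_int f c b.
Proof.
move=> /andP[ac cb] cf; have intf := cont_on_integrable cf.
have := @Rintegral_itvB R f (BLeft a) (BRight b) c intf.
rewrite !bnd_simp => /(_ ac cb).
rewrite Rintegral_itv_obnd_cbnd; last first.
  by apply: integrableS intf => //; apply: subset_itvr; rewrite bnd_simp.
by rewrite /itv_int => <-; rewrite subrKC.
Qed.

Lemma itv_int_cst a b c : a <= b -> itv_int (fun=> c) a b = c * (b - a).
Proof.
move=> ab; rewrite /itv_int Rintegral_cst //= lebesgue_measure_itv /= lte_fin.
case: ltP => // ba; have /eqP -> : a == b by rewrite eq_le ab.
by rewrite subrr.
Qed.

Lemma itv_int_le f g a b : cont_on f a b -> cont_on g a b ->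
  (forall x, a <= x <= b -> f x <= g x) -> itv_int f a b <= itv_int g a b.
Proof.
move=> cf cg fg; apply: le_Rintegral => //; try exact: cont_on_integrable.
Qed.

Lemma eq_itv_int f g a b :
  (forall x, a <= x <= b -> f x = g x) -> itv_int f a b = itv_int g a b.
Proof.
by move=> fg; apply: eq_Rintegral => x /set_mem/=; rewrite in_itv/=; exact: fg.
Qed.

Lemma itv_intD f g a b : cont_on f a b -> cont_on g a b ->
  itv_int (fun x => f x + g x) a b = itv_int f a b + itv_int g a b.
Proof. by move=> cf cg; apply: RintegralD => //; exact: cont_on_integrable. Qed.

Lemma itv_intZ f k a b : cont_on f a b ->
  itv_int (fun x => k * f x) a b = k * itv_int f a b.
Proof. by move=> cf; apply: RintegralZl => //; exact: cont_on_integrable. Qed.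

Lemma itv_int_near_cst f a b c K : a <= b -> cont_on f a b ->
  (forall x, a <= x <= b -> `|f x - c| <= K) ->
  `|itv_int f a b - c * (b - a)| <= K * (b - a).
Proof.
move=> ab cf fK; have cc k : cont_on (fun=> k) a b by move=> x _; exact: cst_continuous.
rewrite ler_distl; apply/andP; split.
  rewrite -mulrBl -itv_int_cst //; apply: itv_int_le => // x /fK.
  by rewrite ler_distl => /andP[].
rewrite -mulrDl -itv_int_cst //; apply: itv_int_le => // x /fK.
by rewrite ler_distl => /andP[].
Qed.

Lemma itv_int_derive f a x : continuous f -> a < x ->
  is_derive x 1 (itv_int f a) (f x).
Proof.
move=> cf ax; have xx : x < x + 1 by rewrite ltrDl.
have intf : mu.-integrable `[a, x + 1] (EFin \o f).
  by apply: cont_on_integrable => y _; exact: cf.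
have [df fE] := continuous_FTC1_closed xx intf ax (cf x).
apply: DeriveDef; first exact: df.
by rewrite -derive1E; exact: fE.
Qed.

(** With [F] a primitive of [f], the derivative of [F (2 * pi + c) - F c] in
    [c] is [f (2 * pi + c) - f c = 0]. *)
Lemma itv_int_shift f c : 0 <= c -> continuous f ->
  (forall x, f (x + 2 * pi) = f x) ->
  itv_int (fun x => f (x + c)) 0 (2 * pi) = itv_int f 0 (2 * pi).
Proof.
move=> c0 cf pf; have pi0 := pi_gt0 R.
pose F := itv_int f (-1).
have dF (y x : R) : 0 <= y + x ->
    is_derive x 1 (fun x : R => F (y + x)) (f (y + x)).
  move=> yx.
  have dFx : is_derive (y + x) 1 F (f (y + x)).
    by apply: itv_int_derive => //; apply: lt_le_trans yx; rewrite oppr_lt0.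
  have dS : is_derive x 1 (fun x : R => y + x) (0 + 1).
    exact: is_deriveD.
  have := is_derive1_comp dFx dS; rewrite add0r mulr1; exact.
have intE (y : R) : 0 <= y ->
    itv_int (fun x => f (y + x)) 0 (2 * pi) = F (y + 2 * pi) - F y.
  move=> y0; rewrite /itv_int /Rintegral.
  have cdF (x : R) : 0 <= y + x -> {for x, continuous (fun x => F (y + x))}.
    by move=> /dF [dFx _]; apply/differentiable_continuous/derivable1_diffP.
  rewrite (@continuous_FTC2 _ _ (fun x => F (y + x))) ?mulr_gt0 //=.
  - by rewrite addr0.
  - apply: continuous_in_subspaceT => x _; apply: continuous_comp;
      [apply: continuousD => //; exact: cst_continuous|exact: cf].
  - split.
    + move=> x; rewrite in_itv /= => /andP[x0 _].
      by case: (dF y x) => //; rewrite addr_ge0 // ltW.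
    + by apply: cvg_at_right_filter; apply: cdF; rewrite addr0.
    + by apply: cvg_at_left_filter; apply: cdF; rewrite addr_ge0 // mulr_ge0 // ltW.
  - move=> x; rewrite in_itv /= => /andP[x0 _].
    have yx : 0 <= y + x by rewrite addr_ge0 // ltW.
    by rewrite derive1E; have [_ ->] := dF y x yx.
rewrite (eq_itv_int (g := fun x => f (c + x))) => [|x _]; last by rewrite addrC.
rewrite intE //.
have := intE 0 (lexx _); rewrite (eq_itv_int (g := f)) => [|x _]; last by rewrite add0r.
move=> ->; move: c0; rewrite le_eqVlt => /predU1P[<-//|c0].
pose H x := F (2 * pi + x) - F (0 + x).
have dH (x : R) : 0 <= x -> is_derive x 1 H 0.
  move=> x0; have -> : 0 = f x - f x by rewrite subrr.
  apply: is_deriveB; first by rewrite -(pf x) addrC; apply: dF;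
     rewrite addr_ge0 // mulr_ge0 // ltW.
  by rewrite -{2}(add0r x); apply: dF; rewrite add0r.
have [||x xc] := @MVT R H (fun=> 0) 0 c c0.
- by move=> x; rewrite in_itv /= => /andP[/ltW x0 _]; exact: dH.
- apply: continuous_in_subspaceT => x /set_mem /=; rewrite in_itv /= => /andP[x0 _].
  by have [dHx _] := dH x x0; apply/differentiable_continuous/derivable1_diffP.
rewrite mul0r /H => /eqP; rewrite subr_eq0 !add0r !addr0 => /eqP HH.
by rewrite (addrC c) HH.
Qed.
End integral.

(** * The mean of log (al - be cos t) over a period *)

Section log_mean.
Context {R : realType}.
Implicit Types (al be th rho t : R) (m n : nat).

Definition log_cos al be m th t : R := ln (al - be * cos (m%:R * t + th)).

Lemma log_cos_arg_gt0 al be x : 0 <= be -> be < al -> 0 < al - be * cos x.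
Proof.
move=> be0 bal; rewrite subr_gt0 (le_lt_trans _ bal) //.
by rewrite ler_piMr // cos_le1.
Qed.

Lemma continuous_log_cos al be m th : 0 <= be -> be < al ->
  continuous (log_cos al be m th).
Proof.
move=> be0 bal t; apply: (@continuous_comp R R R (fun t : R => al - be * cos
  (m%:R * t + th)) (@ln R)).
  apply: continuousB; first exact: cst_continuous.
  apply: continuousM; first exact: cst_continuous.
  apply: (@continuous_comp R R R (fun t : R => m%:R * t + th) (@cos R));
    last exact: continuous_cos.
  apply: continuousD; last exact: cst_continuous.
  by apply: continuousM => //; exact: cst_continuous.
by apply: continuous_ln; exact: log_cos_arg_gt0.
Qed.

Lemma cosDn2pi x m : cos (x + m%:R * (2 * pi)) = cos x :> R.
Proof. by rewrite mulr_natl mulr_natl (periodicn (@cosD2pi R)). Qed.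

(** Shifting by [pi / m] changes the sign of the cosine and not the integral,
    so twice the integral is the integral of the logarithm of [(al - be * cos
    x) * (al + be * cos x)], which is again of the same form with the angle
    doubled. *)
Lemma log_cos_int_double al be m th : 0 <= be -> be < al -> (0 < m)%N ->
  2 * itv_int (log_cos al be m th) 0 (2 * pi) =
  itv_int (log_cos (al ^+ 2 - be ^+ 2 / 2) (be ^+ 2 / 2) (2 * m) (th *+ 2))
    0 (2 * pi).
Proof.
move=> be0 bal m0.
have m0' : m%:R != 0 :> R by rewrite pnatr_eq0 -lt0n.
have clc := @continuous_log_cos al be m th be0 bal.
rewrite mulr_natl mulr2n -[X in X + _](itv_int_shift (c := pi / m%:R)) //; last 2 first.
- by rewrite divr_ge0 ?pi_ge0.
- by move=> x; rewrite /log_cos mulrDr addrAC cosDn2pi.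
rewrite -itv_intD; last 2 first.
- move=> x _; apply: continuous_comp; last exact: clc.
  by apply: continuousD => //; exact: cst_continuous.
- by move=> x _; exact: clc.
apply: eq_itv_int => x _; rewrite /log_cos.
rewrite -lnM ?posrE ?log_cos_arg_gt0 //; congr ln.
have -> : m%:R * (x + pi / m%:R) + th = m%:R * x + th + pi by field.
have -> : (2 * m)%:R * x + th *+ 2 = (m%:R * x + th) *+ 2.
  by rewrite natrM; ring.
by rewrite cosDpi cos_mulr2n; field.
Qed.

Lemma natr_le_expn2 n : n%:R <= 2 ^+ n :> R.
Proof. by rewrite -natrX ler_nat ltnW // ltn_expl. Qed.

Lemma ge0_from_doubling (k x : R) : (forall n, k <= x * 2 ^+ n) -> 0 <= x.
Proof.
move=> kx; rewrite leNgt; apply/negP => x0.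
pose n := Num.truncn (k / x).
have /le_lt_trans := kx n.+1.
suff /[swap]/[apply] : x * 2 ^+ n.+1 < k by rewrite ltxx.
apply: (@le_lt_trans _ _ (x * n.+1%:R)).
  by rewrite ler_nM2l // natr_le_expn2.
by rewrite mulrC -ltr_ndivrMr // truncnS_gt.
Qed.

(** The region [1 + be ^+ 2 / 4 <= al], [c <= al - be] is stable under the
    doubling [al' = al ^+ 2 - be ^+ 2 / 2], [be' = be ^+ 2 / 2], because [al' -
    be' = (al - be) * (al + be)] and [1 <= al + be]. So after [n] doublings the
    crude bound [ln c] still applies to an integral that has been multiplied by
    [2 ^+ n]. *)
Lemma log_cos_int_lower n al be m th c : (0 < m)%N -> 0 <= be ->
    1 + be ^+ 2 / 4 <= al -> 0 < c -> c <= al - be ->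
  ln c * (2 * pi) <= itv_int (log_cos al be m th) 0 (2 * pi) * 2 ^+ n.
Proof.
elim: n al be m th => [|n IH] al be m th m0 be0 al1 c0 cab.
  have bal : be < al by rewrite -subr_gt0 (lt_le_trans c0).
  have pi0 : 0 <= 2 * pi :> R by rewrite mulr_ge0 // pi_ge0.
  rewrite expr0 mulr1 -[2 * pi in leLHS]subr0 -itv_int_cst //.
  apply: itv_int_le => [x _|x _|x _]; first exact: cst_continuous.
    exact: continuous_log_cos.
  rewrite /log_cos ler_ln ?posrE ?log_cos_arg_gt0 //.
  apply: (le_trans cab); rewrite lerB // ler_piMr // cos_le1.
have bal : be < al by rewrite -subr_gt0 (lt_le_trans c0).
rewrite (exprS 2 n) [_ * (2 * 2 ^+ n)]mulrCA [2 * (_ * 2 ^+ n)]mulrA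
  log_cos_int_double //; apply: IH => //.
- by rewrite muln_gt0.
- by rewrite divr_ge0 // exprn_ge0.
- have : 1 + be ^+ 2 / 4 >= 0 by nra.
  nra.
- nra.
Qed.

(** Jensen's inequality for a disc: since [1 + be ^+ 2 / 4 <= al], the argument
    [al - be * cos x] dominates the squared modulus of [1 - be / 2 * e ^ (i
    x)]. The margin [be < al] keeps the integrand continuous. *)
Lemma log_cos_int_ge0 al be m th : (0 < m)%N -> 0 <= be -> be < al ->
    1 + be ^+ 2 / 4 <= al ->
  0 <= itv_int (log_cos al be m th) 0 (2 * pi).
Proof.
move=> m0 be0 bal al1; apply: (@ge0_from_doubling (ln (al - be) * (2 * pi))) => n.
by apply: log_cos_int_lower => //; rewrite subr_gt0.
Qed.

(** Here [al - be * cos x] is the squared modulus of [1 - rho * e ^ (i x)], and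
    doubling the angle replaces [rho] by [rho ^+ 2]. This squared modulus is at
    most 4 throughout. *)
Lemma log_cos_int_upper n rho m th : (0 < m)%N -> 0 <= rho < 1 ->
  itv_int (log_cos (1 + rho ^+ 2) (2 * rho) m th) 0 (2 * pi) * 2 ^+ n <=
  ln 4 * (2 * pi).
Proof.
elim: n rho m th => [|n IH] rho m th m0 /andP[rho0 rho1].
  have bal : 2 * rho < 1 + rho ^+ 2 by nra.
  have be0 : 0 <= 2 * rho by rewrite mulr_ge0.
  have pi0 : 0 <= 2 * pi :> R by rewrite mulr_ge0 // pi_ge0.
  rewrite expr0 mulr1 -[2 * pi in leRHS]subr0 -itv_int_cst //.
  apply: itv_int_le => [x _|x _|x _]; last 2 first.
  - exact: cst_continuous.
  - rewrite /log_cos ler_ln ?posrE ?log_cos_arg_gt0 //.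
    have := cos_geN1 (m%:R * x + th); nra.
  exact: continuous_log_cos.
have bal : 2 * rho < 1 + rho ^+ 2 by nra.
have be0 : 0 <= 2 * rho by rewrite mulr_ge0.
rewrite (exprS 2 n) [_ * (2 * 2 ^+ n)]mulrCA [2 * (_ * 2 ^+ n)]mulrA
  log_cos_int_double //.
have -> : (1 + rho ^+ 2) ^+ 2 - (2 * rho) ^+ 2 / 2 = 1 + (rho ^+ 2) ^+ 2 by field.
have -> : (2 * rho) ^+ 2 / 2 = 2 * rho ^+ 2 by field.
by apply: IH; rewrite ?muln_gt0 //; nra.
Qed.

(** Together with [log_cos_int_ge0] this gives the mean value of [ln] of the
    modulus over circles that do not enclose the origin. *)
Lemma log_cos_int_le0 rho m th : (0 < m)%N -> 0 <= rho < 1 ->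
  itv_int (log_cos (1 + rho ^+ 2) (2 * rho) m th) 0 (2 * pi) <= 0.
Proof.
move=> m0 rho1; rewrite -oppr_ge0.
apply: (@ge0_from_doubling (- (ln 4 * (2 * pi)))) => n.
by rewrite mulNr lerN2 log_cos_int_upper.
Qed.
End log_mean.

(** * Goursat: closed forms with merely differentiable coefficients *)

Section goursat.
Context {R : realType}.
Implicit Types (P Q : R -> R -> R) (s t l h : R).

Lemma continuous_lipschitz_at (f : R -> R) (x K d : R) : 0 < d ->
    (forall y, `|y - x| <= d -> `|f y - f x| <= K * `|y - x|) ->
  {for x, continuous f}.
Proof.
move=> d0 fK; apply/cvgrPdist_le => e e0.
have K0 : 0 < `|K| + 1 by rewrite ltr_pwDr.
near=> y.
have yx : `|y - x| <= Num.min d (e / (`|K| + 1)).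
  rewrite distrC; near: y; apply/nbhs_normP.
  exists (Num.min d (e / (`|K| + 1))); first by rewrite /= lt_min d0 divr_gt0.
  by move=> y /ltW.
move: yx; rewrite le_min => /andP[yxd yxe].
rewrite distrC (le_trans (fK y yxd)) //.
apply: (@le_trans _ _ ((`|K| + 1) * `|y - x|)).
  by rewrite ler_wpM2r // (le_trans (ler_norm K)) // lerDl.
by rewrite mulrC -ler_pdivlMr.
Unshelve. all: by end_near. Qed.

(** The form [P ds + Q dt] is Frechet differentiable at [(s, t)] and the two
    mixed derivatives [P_t] and [Q_s] have the same value [c]. *)
Definition closed_at P Q s t := exists c p q, forall e, 0 < e ->
  exists2 d, 0 < d & forall x y, `|x - s| <= d -> `|y - t| <= d ->
    `|P x y - P s t - p * (x - s) - c * (y - t)| <= e * (`|x - s| + `|y - t|) /\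
    `|Q x y - Q s t - c * (x - s) - q * (y - t)| <= e * (`|x - s| + `|y - t|).

Lemma closed_at_continuous P Q s t : closed_at P Q s t ->
  {for s, continuous (P^~ t)} /\ {for t, continuous (Q s)}.
Proof.
move=> [c [p [q /(_ 1 ltr01)[d d0 PQ]]]].
have tt : `|t - t| <= d by rewrite subrr normr0 ltW.
have ss : `|s - s| <= d by rewrite subrr normr0 ltW.
split.
  apply: (@continuous_lipschitz_at _ _ (1 + `|p|) _ d0) => x xs.
  have [+ _] := PQ x t xs tt.
  rewrite subrr mulr0 subr0 normr0 addr0 mul1r => H.
  rewrite mulrDl mul1r -normrM -[X in `|X| <= _](subrK (p * (x - s))).
  by rewrite (le_trans (ler_normD _ _)) // lerD2r.
apply: (@continuous_lipschitz_at _ _ (1 + `|q|) _ d0) => y yt.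
have [_] := PQ s y ss yt.
rewrite subrr mulr0 subr0 normr0 add0r mul1r => H.
rewrite mulrDl mul1r -normrM -[X in `|X| <= _](subrK (q * (y - t))).
by rewrite (le_trans (ler_normD _ _)) // lerD2r.
Qed.

(** The integral of [P ds + Q dt] over the boundary of the rectangle with
    corner [(s, t)] and sides [l], [h], counterclockwise. *)
Definition rect_int P Q s t l h : R :=
  itv_int (P^~ t) s (s + l) - itv_int (P^~ (t + h)) s (s + l) +
  (itv_int (Q (s + l)) t (t + h) - itv_int (Q s) t (t + h)).

Definition closed_on P Q s t l h := forall x y,
  s <= x <= s + l -> t <= y <= t + h -> closed_at P Q x y.

Lemma rect_int_split P Q s t l h : 0 <= l -> 0 <= h -> closed_on P Q s t l h ->
  rect_int P Q s t l h =
    rect_int P Q s t (l / 2) (h / 2) + rect_int P Q (s + l / 2) t (l / 2) (h / 2) +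
    (rect_int P Q s (t + h / 2) (l / 2) (h / 2) +
     rect_int P Q (s + l / 2) (t + h / 2) (l / 2) (h / 2)).
Proof.
move=> l0 h0 PQ; rewrite /rect_int.
have sl : s + l / 2 + l / 2 = s + l by field.
have th : t + h / 2 + h / 2 = t + h by field.
have cP y : t <= y <= t + h -> cont_on (P^~ y) s (s + l).
  by move=> yt x xs; have [] := closed_at_continuous (PQ x y xs yt).
have cQ x : s <= x <= s + l -> cont_on (Q x) t (t + h).
  by move=> xs y yt; have [] := closed_at_continuous (PQ x y xs yt).
have ms : s <= s + l / 2 <= s + l by apply/andP; split; lra.
have mt : t <= t + h / 2 <= t + h by apply/andP; split; lra.
rewrite !sl !th.
rewrite !(itv_int_split (a := s) ms); [|by apply: cP; rewrite ?lexx; lra..].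
rewrite !(itv_int_split (a := t) mt); [|by apply: cQ; rewrite ?lexx; lra..].
ring.
Qed.

(** The linear parts of [P] and [Q] contribute [- c * l * h] and [c * l * h],
    which cancel; only the remainders are left, of size [e * (l + h)] on a
    boundary of length [2 * (l + h)]. *)
Lemma rect_int_small P Q s t l h x y c p q e : 0 <= l -> 0 <= h -> 0 < e ->
    closed_on P Q s t l h -> s <= x <= s + l -> t <= y <= t + h ->
    (forall x' y', s <= x' <= s + l -> t <= y' <= t + h ->
    `|P x' y' - P x y - p * (x' - x) - c * (y' - y)|
      <= e * (`|x' - x| + `|y' - y|) /\
    `|Q x' y' - Q x y - c * (x' - x) - q * (y' - y)|
      <= e * (`|x' - x| + `|y' - y|)) ->
  `|rect_int P Q s t l h| <= 2 * e * (l + h) ^+ 2.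
Proof.
move=> l0 h0 e0 PQ xs yt H.
have cP y' : t <= y' <= t + h -> cont_on (P^~ y') s (s + l).
  by move=> yt' x' xs'; have [] := closed_at_continuous (PQ x' y' xs' yt').
have cQ x' : s <= x' <= s + l -> cont_on (Q x') t (t + h).
  by move=> xs' y' yt'; have [] := closed_at_continuous (PQ x' y' xs' yt').
have diam x' y' : s <= x' <= s + l -> t <= y' <= t + h ->
    e * (`|x' - x| + `|y' - y|) <= e * (l + h).
  move=> xs' yt'; rewrite ler_pM2l //; apply: lerD; rewrite ler_distl;
    by apply/andP; split; lra.
have s1 : s <= s <= s + l by lra.
have s2 : s <= s + l <= s + l by lra.
have t1 : t <= t <= t + h by lra.
have t2 : t <= t + h <= t + h by lra.
have cN f a b : cont_on f a b -> cont_on (fun x => - 1 * f x : R) a b.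
  by move=> cf z zab; apply: cvgM; [exact: cvg_cst|exact: cf].
have cD f g a b : cont_on f a b -> cont_on g a b ->
    cont_on (fun x => f x + g x : R) a b.
  by move=> cf cg z zab; apply: cvgD; [exact: cf|exact: cg].
have intB f g a b : cont_on f a b -> cont_on g a b ->
    itv_int f a b - itv_int g a b = itv_int (fun x => f x + -1 * g x : R) a b.
  by move=> cf cg; rewrite itv_intD // ?itv_intZ ?mulN1r //; exact: cN.
rewrite /rect_int (intB _ _ _ _ (cP _ t1) (cP _ t2)).
rewrite (intB _ _ _ _ (cQ _ s2) (cQ _ s1)).
have IP := @itv_int_near_cst R (fun x => P x t + -1 * P x (t + h)) s (s + l)
  (- (c * h)) (2 * (e * (l + h))).
have IQ := @itv_int_near_cst R (fun y => Q (s + l) y + -1 * Q s y) t (t + h)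
  (c * l) (2 * (e * (l + h))).
have {IP} := IP _ (cD _ _ _ _ (cP _ t1) (cN _ _ _ (cP _ t2))) _.
have {IQ} := IQ _ (cD _ _ _ _ (cQ _ s2) (cN _ _ _ (cQ _ s1))) _.
move=> IQ IP.
have -> : itv_int (fun x => P x t + -1 * P x (t + h)) s (s + l) +
   itv_int (fun y => Q (s + l) y + -1 * Q s y) t (t + h) =
   (itv_int (fun x => P x t + -1 * P x (t + h)) s (s + l) - - (c * h) * (s + l - s))
   + (itv_int (fun y => Q (s + l) y + -1 * Q s y) t (t + h) - c * l * (t + h - t)).
  by ring.
apply: (le_trans (ler_normD _ _)).
have -> : 2 * e * (l + h) ^+ 2 = 2 * (e * (l + h)) * (s + l - s) +
   2 * (e * (l + h)) * (t + h - t) by ring.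
apply: lerD.
  apply: IP; first by lra.
  move=> x' xs'; have [A _] := H x' t xs' t1; have [B _] := H x' (t + h) xs' t2.
  have := le_trans (ler_normB _ _) (lerD (le_trans A (diam _ _ xs' t1))
    (le_trans B (diam _ _ xs' t2))).
  set u := (X in `|X| <= _); set v := (X in _ -> `|X| <= _).
  have -> : u = v by rewrite /u /v; ring.
  by rewrite mulr_natl mulr2n.
apply: IQ; first by lra.
move=> y' yt'; have [_ A] := H _ y' s2 yt'; have [_ B] := H _ y' s1 yt'.
have := le_trans (ler_normB _ _) (lerD (le_trans A (diam _ _ s2 yt'))
  (le_trans B (diam _ _ s1 yt'))).
set u := (X in `|X| <= _); set v := (X in _ -> `|X| <= _).
have -> : u = v by rewrite /u /v; ring.
by rewrite mulr_natl mulr2n.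
Qed.

Lemma nested_halving (a : nat -> R) l : 0 <= l ->
    (forall n, a n <= a n.+1 <= a n + l / 2 ^+ n.+1) ->
  exists x, forall n, a n <= x <= a n + l / 2 ^+ n.
Proof.
move=> l0 aS.
have p2 n : 0 < 2 ^+ n :> R by rewrite exprn_gt0.
have half n : l / 2 ^+ n.+1 + l / 2 ^+ n.+1 = l / 2 ^+ n.
  by rewrite exprS; field; rewrite gt_eqF.
have up n k : a n <= a (n + k)%N <= a n + l / 2 ^+ n - l / 2 ^+ (n + k).
  elim: k => [|k /andP[IH1 IH2]]; first by rewrite addn0; lra.
  have /andP[A1 A2] := aS (n + k)%N; have := half (n + k)%N.
  by rewrite addnS => E; apply/andP; split; lra.
have ub n m : a m <= a n + l / 2 ^+ n.
  have [nm|/ltnW mn] := leqP n m.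
    have /andP[_] := up n (m - n)%N; rewrite subnKC // => H.
    by rewrite (le_trans H) // gerBl divr_ge0 // ltW.
  have /andP[+ _] := up m (n - m)%N; rewrite subnKC // => H.
  by rewrite (le_trans H) // lerDl divr_ge0 // ltW.
exists (sup (range a)) => n; apply/andP; split.
  by apply: ub_le_sup; [exists (a 0 + l / 2 ^+ 0) => _ [m _ <-]|exists n].
by apply: ge_sup; [exists (a 0); exists 0|move=> _ [m _ <-]].
Qed.

(** If the integral were nonzero, repeated quartering would give nested
    rectangles whose integrals decrease at most like [4 ^- n]; at their common
    point [rect_int_small] makes them decrease faster. *)
Lemma goursat P Q s t l h : 0 <= l -> 0 <= h -> closed_on P Q s t l h ->
  rect_int P Q s t l h = 0.
Proof.
move=> l0 h0 PQ; apply: contrapT => /eqP; rewrite -normr_gt0.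
set e := `|_| => e0.
pose Bad n (z : R * R) := [/\ s <= z.1, z.1 + l / 2 ^+ n <= s + l,
  t <= z.2, z.2 + h / 2 ^+ n <= t + h &
  e / 4 ^+ n <= `|rect_int P Q z.1 z.2 (l / 2 ^+ n) (h / 2 ^+ n)|].
pose Next n (z z' : R * R) := Bad n.+1 z' /\
  (z.1 <= z'.1 <= z.1 + l / 2 ^+ n.+1) /\ (z.2 <= z'.2 <= z.2 + h / 2 ^+ n.+1).
have p2 n : 0 < 2 ^+ n :> R by rewrite exprn_gt0.
have p4 n : 0 < 4 ^+ n :> R by rewrite exprn_gt0.
have halfE k n : k / 2 ^+ n / 2 = k / 2 ^+ n.+1 :> R.
  by rewrite exprS; field; rewrite gt_eqF.
have closed_sub n z : Bad n z ->
    closed_on P Q z.1 z.2 (l / 2 ^+ n) (h / 2 ^+ n).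
  by move=> [z1 z2 z3 z4 _] x y xs yt; apply: PQ; lra.
have step n z : Bad n z -> exists z', Next n z z'.
  move=> Bz; have := closed_sub _ _ Bz; case: Bz => z1 z2 z3 z4 ez cz.
  have ln0 : 0 <= l / 2 ^+ n.+1 by rewrite divr_ge0 // ltW.
  have hn0 : 0 <= h / 2 ^+ n.+1 by rewrite divr_ge0 // ltW.
  have lE : l / 2 ^+ n = l / 2 ^+ n.+1 + l / 2 ^+ n.+1 by rewrite -halfE; field.
  have hE : h / 2 ^+ n = h / 2 ^+ n.+1 + h / 2 ^+ n.+1 by rewrite -halfE; field.
  have eE : e / 4 ^+ n = e / 4 ^+ n.+1 + e / 4 ^+ n.+1 +
      (e / 4 ^+ n.+1 + e / 4 ^+ n.+1).
    by rewrite exprS; field; rewrite gt_eqF.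
  move: ez; rewrite rect_int_split ?divr_ge0 ?(ltW (p2 _)) // !halfE.
  set L := l / _ in ln0 lE *; set H := h / _ in hn0 hE *.
  rewrite eE; set k := e / _.
  rewrite lE in z2; rewrite hE in z4.
  have [k1|k1] := lerP k `|rect_int P Q z.1 z.2 L H|.
    by move=> _; exists z; rewrite /Next /Bad -/L -/H; split; [split => //; lra|lra].
  have [k2|k2] := lerP k `|rect_int P Q (z.1 + L) z.2 L H|.
    by move=> _; exists (z.1 + L, z.2); rewrite /Next /Bad /= -/L -/H;
      split; [split => //; lra|lra].
  have [k3|k3] := lerP k `|rect_int P Q z.1 (z.2 + H) L H|.
    by move=> _; exists (z.1, z.2 + H); rewrite /Next /Bad /= -/L -/H;
      split; [split => //; lra|lra].
  have [k4|k4] := lerP k `|rect_int P Q (z.1 + L) (z.2 + H) L H|.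
    by move=> _; exists (z.1 + L, z.2 + H); rewrite /Next /Bad /= -/L -/H;
      split; [split => //; lra|lra].
  move=> ke; exfalso; move: ke; apply/negP; rewrite -ltNge.
  apply: le_lt_trans (ler_normD _ _) _; apply: ltrD.
    by apply: le_lt_trans (ler_normD _ _) _; apply: ltrD.
  by apply: le_lt_trans (ler_normD _ _) _; apply: ltrD.
have next nz : exists z', Bad nz.1 nz.2 -> Next nz.1 nz.2 z'.
  have [/step[z' zz']|nB] := EM (Bad nz.1 nz.2); first by exists z'.
  by exists nz.2.
have [f fP] := boolp.choice next.
pose u := fix u n := if n is m.+1 then f (m, u m) else (s, t).
have uB n : Bad n (u n).
  elim: n => [|n IH]; last by have [] := fP (n, u n) IH.
  by rewrite /Bad /= !expr0 !divr1; split.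
have uN n : Next n (u n) (u n.+1) by apply: (fP (n, u n)) (uB n).
have [x xu] := nested_halving l0 (fun n => (uN n).2.1).
have [y yu] := nested_halving h0 (fun n => (uN n).2.2).
have xs : s <= x <= s + l by have := xu 0; rewrite /= expr0 divr1.
have yt : t <= y <= t + h by have := yu 0; rewrite /= expr0 divr1.
have [c [p [q Hc]]] := PQ x y xs yt.
have lh0 : 0 < 4 * ((l + h) ^+ 2 + 1) by rewrite mulr_gt0 // ltr_wpDl // sqr_ge0.
have [d d0 Hd] := Hc (e / (4 * ((l + h) ^+ 2 + 1))) (divr_gt0 e0 lh0).
pose n := (Num.truncn ((l + h) / d)).+1.
have small : (l + h) / 2 ^+ n <= d.
  rewrite ler_pdivrMr // mulrC -ler_pdivrMr //.
  by rewrite (le_trans _ (natr_le_expn2 n)) // ltW // truncnS_gt.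
have lhn : l / 2 ^+ n + h / 2 ^+ n = (l + h) / 2 ^+ n by rewrite mulrDl.
have ln0 : 0 <= l / 2 ^+ n by rewrite divr_ge0 // ltW.
have hn0 : 0 <= h / 2 ^+ n by rewrite divr_ge0 // ltW.
have := @rect_int_small P Q (u n).1 (u n).2 (l / 2 ^+ n) (h / 2 ^+ n) x y c p q _
  ln0 hn0 (divr_gt0 e0 lh0) (closed_sub _ _ (uB n)) (xu n) (yu n).
have /andP[xu1 xu2] := xu n; have /andP[yu1 yu2] := yu n.
case: (uB n) => z1 z2 z3 z4 ez.
move=> /(_ _)/(le_trans ez); rewrite lhn => bound.
have {bound} : e / 4 ^+ n <= 2 * (e / (4 * ((l + h) ^+ 2 + 1))) * ((l + h) / 2 ^+ n) ^+ 2.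
  apply: bound => x' y' /andP[x1 x2] /andP[y1 y2].
  by apply: Hd; clear -small lhn ln0 hn0 xu1 xu2 yu1 yu2 x1 x2 y1 y2;
    rewrite ler_distl; apply/andP; split; lra.
have -> : 2 * (e / (4 * ((l + h) ^+ 2 + 1))) * ((l + h) / 2 ^+ n) ^+ 2 =
    (e / 4 ^+ n) * ((l + h) ^+ 2 / (2 * ((l + h) ^+ 2 + 1))).
  have -> : 4 ^+ n = (2 ^+ n) ^+ 2 :> R by rewrite -exprM mulnC exprM;
    congr (_ ^+ _); ring.
  by field; rewrite !gt_eqF // ltr_wpDl // sqr_ge0.
rewrite ler_pMr ?divr_gt0 // ler_pdivlMr; have := sqr_ge0 (l + h); lra.
Qed.
End goursat.

(** * Real-valued modulus and complex derivatives *)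

Section modulus.
Context {R : realType}.
Implicit Types (w z a : R[i]) (x y : R).

Lemma norm_modulus w : `|w| = (modulus w)%:C%C.
Proof. by []. Qed.

Lemma modulus_ge0 w : 0 <= modulus w.
Proof. by case: w => x y; rewrite /modulus /= sqrtr_ge0. Qed.

Lemma modulusM w z : modulus (w * z) = modulus w * modulus z.
Proof. exact: ComplexField.Normc.normcM. Qed.

Lemma modulus_real x : modulus x%:C%C = `|x|.
Proof. by rewrite /modulus /= expr0n addr0 sqrtr_sqr. Qed.

Lemma modulus0 : modulus (0 : R[i]) = 0.
Proof. exact: ComplexField.Normc.normc0. Qed.

Lemma modulus1 : modulus (1 : R[i]) = 1.
Proof. exact: ComplexField.Normc.normc1. Qed.

Lemma modulusN w : modulus (- w) = modulus w.
Proof. exact: normcN. Qed.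

Lemma modulusD w z : modulus (w + z) <= modulus w + modulus z.
Proof. exact: le_normcD. Qed.

Lemma modulus_distC w z : modulus (w - z) = modulus (z - w).
Proof. by rewrite -modulusN opprB. Qed.

Lemma modulus_eq0 w : (modulus w == 0) = (w == 0).
Proof.
apply/eqP/eqP => [|->]; last exact: modulus0.
exact: ComplexField.Normc.eq0_normc.
Qed.

Lemma modulus_gt0 w : (0 < modulus w) = (w != 0).
Proof. by rewrite lt_def modulus_ge0 andbT modulus_eq0. Qed.

Lemma modulusV w : modulus w^-1 = (modulus w)^-1.
Proof. exact: ComplexField.Normc.normcV. Qed.

Lemma modulusX w n : modulus (w ^+ n) = modulus w ^+ n.
Proof. by elim: n => [|n IH]; rewrite ?modulus1 // !exprS modulusM IH. Qed.

Lemma modulus_sqr w : modulus w ^+ 2 = complex.Re w ^+ 2 + complex.Im w ^+ 2.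
Proof. by case: w => x y; rewrite /modulus /= sqr_sqrtr // addr_ge0 ?sqr_ge0. Qed.

Lemma Re_le_modulus w : `|complex.Re w| <= modulus w.
Proof.
rewrite -(@ler_pXn2r _ 2) ?nnegrE ?modulus_ge0 ?normr_ge0 // modulus_sqr.
by rewrite real_normK ?num_real // lerDl sqr_ge0.
Qed.

Lemma Im_le_modulus w : `|complex.Im w| <= modulus w.
Proof.
rewrite -(@ler_pXn2r _ 2) ?nnegrE ?modulus_ge0 ?normr_ge0 // modulus_sqr.
by rewrite real_normK ?num_real // lerDr sqr_ge0.
Qed.

Lemma modulus_le_ReIm w : modulus w <= `|complex.Re w| + `|complex.Im w|.
Proof.
rewrite -(@ler_pXn2r _ 2) ?nnegrE ?modulus_ge0 ?addr_ge0 // modulus_sqr.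
rewrite -(real_normK (num_real (complex.Re w))) -(real_normK (num_real (complex.Im w))).
have := mulr_ge0 (normr_ge0 (complex.Re w)) (normr_ge0 (complex.Im w)).
set u := `|_|; set v := `|_|; nra.
Qed.

(** The norm of [R[i]] takes its values in [R[i]], so the radii of its balls
    are complex; this gives access to neighbourhoods by real radii. *)
Lemma nbhs_modulus (a : R[i]^o) (P : R[i]^o -> Prop) :
  (\forall w \near a, P w) <->
  exists2 e : R, 0 < e & forall w, modulus (w - a) < e -> P w.
Proof.
split.
  move=> /nbhs_ballP[e /= e0 aP].
  have eE : e = (complex.Re e)%:C%C.
    by case: e e0 {aP} => x y; rewrite ltcE /= => /andP[/eqP ->].
  exists (complex.Re e); first by move: e0; rewrite eE ltcR.
  move=> w wa; apply: aP; rewrite -ball_normE /= eE norm_modulus ltcR.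
  by rewrite modulus_distC.
move=> [e e0 aP]; apply/nbhs_ballP; exists (e%:C)%C; first by rewrite /= ltcR.
move=> w; rewrite -ball_normE /= norm_modulus ltcR modulus_distC; exact: aP.
Qed.

(** Complex differentiability in terms of real radii and the real-valued
    modulus, the form in which it is combined with the polar coordinates below.
    *)
Definition cderiv (q : R[i] -> R[i]) a d := forall e : R, 0 < e ->
  exists2 r : R, 0 < r & forall w, modulus (w - a) <= r ->
    modulus (q w - q a - d * (w - a)) <= e * modulus (w - a).

Lemma derive_expansion (K : numFieldType) (f : K^o -> K^o) (a d e : K) :
    is_derive (a : K^o) 1 f d -> 0 < e ->
  \forall w \near (a : K^o), `|f w - f a - d * (w - a)| <= e * `|w - a|.
Proof.
move=> [df fd] e0.
have : h^-1 *: (f (h *: (1 : K^o) + a) - f a) @[h --> (0 : K)^'] --> (d : K^o).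
  by rewrite -fd; exact: df.
move=> /cvgrPdist_le/(_ e e0) H.
have {}H : \forall h \near (0 : K), h != 0 ->
    `|d - h^-1 *: (f (h *: (1 : K^o) + a) - f a)| <= e.
  by move: H; rewrite near_withinE.
move/nbhs_ballP : H => [r /= r0 H]; apply/nbhs_ballP; exists r => // w /=.
rewrite -ball_normE /= => aw.
have [->|wa] := eqVneq w a; first by rewrite !subrr mulr0 subr0 normr0 mulr0.
have wa0 : w - a != 0 by rewrite subr_eq0.
have := H (w - a); rewrite -ball_normE /= sub0r normrN [`|w - a|]distrC => /(_ aw wa0).
have -> : (w - a) *: (1 : K^o) + a = w by rewrite /GRing.scale /= mulr1 subrK.
move=> dle.
have -> : f w - f a - d * (w - a) =
    - ((d - (w - a)^-1 * (f w - f a)) * (w - a)).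
  by rewrite mulrBl mulrAC mulVf // mul1r opprB.
by rewrite normrN normrM (distrC a w); apply: ler_wpM2r; [exact: normr_ge0|exact: dle].
Qed.

Lemma cderiv_of_is_derive (q : R[i]^o -> R[i]^o) a d :
  is_derive (a : R[i]^o) 1 q d -> cderiv q a d.
Proof.
move=> dq e e0; have e0' : 0 < (e%:C)%C :> R[i] by rewrite ltcR.
have /nbhs_modulus[r r0 H] := derive_expansion dq e0'.
exists (r / 2); first by rewrite divr_gt0.
move=> w wr; have := H w (le_lt_trans wr _).
rewrite !norm_modulus -rmorphM lecR; apply.
by rewrite ltr_pdivrMr // ltr_pMr // ltr1n.
Qed.

Lemma real_derive_expansion (f : R -> R) (x d : R) (e : R) : is_derive x 1 f d -> 0 < e ->
  exists2 r, 0 < r & forall y, `|y - x| <= r -> `|f y - f x - d * (y - x)| <= e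
    * `|y - x|.
Proof.
move=> df e0; have /nbhs_normP[r /= r0 H] := @derive_expansion R f x d e df e0.
exists (r / 2); first by rewrite divr_gt0.
move=> y yr; apply: H; rewrite /ball_ /= distrC (le_lt_trans yr) //.
by rewrite ltr_pdivrMr // ltr_pMr // ltr1n.
Qed.
End modulus.

(** * The mean value property *)

Section mean_value.
Context {R : realType}.
Implicit Types (w z a : R[i]) (s t x y r e : R).

(** The complex exponential of [s + i t]. *)
Definition polar s t : R[i] := (expR s * cos t +i* (expR s * sin t))%C.

Lemma polarD s t x y : polar (s + x) (t + y) = polar s t * polar x y.
Proof.
apply/eqP; rewrite eq_complex /= expRD cosD sinD.
by apply/andP; split; apply/eqP; ring.
Qed.

Lemma modulus_polar s t : modulus (polar s t) = expR s.
Proof.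
rewrite /modulus /= !exprMn -mulrDr cos2Dsin2 mulr1 sqrtr_sqr.
by rewrite ger0_norm // expR_ge0.
Qed.

Lemma circle_point_polar a r t : 0 < r -> circle_point a r t = a + polar (ln r) t.
Proof. by move=> r0; rewrite /circle_point /polar lnK. Qed.

Lemma modulus_circle_point a r t : 0 < r -> modulus (circle_point a r t - a) = r.
Proof.
by move=> r0; rewrite circle_point_polar // addrC addKr modulus_polar lnK.
Qed.

Lemma polar_expansion_at0 e : 0 < e -> exists2 d, 0 < d &
  forall x y, `|x| <= d -> `|y| <= d ->
    modulus (polar x y - 1 - (x +i* y)%C) <= e * (`|x| + `|y|).
Proof.
move=> e0; pose k := Num.min (1 / 2) (e / 6).
have k0 : 0 < k by rewrite lt_min !divr_gt0.
have k12 : k <= 1 / 2 by rewrite ge_min lexx.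
have ke : k <= e / 6 by rewrite ge_min lexx orbT.
clearbody k.
have [d1 d10 H1] := real_derive_expansion (is_derive_expR (0 : R)) k0.
have [d2 d20 H2] := real_derive_expansion (is_derive_cos (0 : R)) k0.
have [d3 d30 H3] := real_derive_expansion (is_derive_sin (0 : R)) k0.
exists (Num.min (Num.min d1 d2) (Num.min d3 k)); first by rewrite !lt_min d10 d20 d30.
move=> x y; rewrite !le_min => /andP[/andP[x1 _] /andP[_ xk]].
move=> /andP[/andP[_ y2] /andP[y3 _]].
have {H1} := H1 x; rewrite subr0 expR0 mul1r => /(_ x1) E1.
have {H2} := H2 y; rewrite subr0 cos0 sin0 oppr0 mul0r subr0 => /(_ y2) E2.
have {H3} := H3 y; rewrite subr0 cos0 sin0 mul1r subr0 => /(_ y3) E3.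
have x0 := normr_ge0 x; have y0 := normr_ge0 y.
have kx := ler_wpM2r x0 k12; have ky := ler_wpM2r y0 k12.
have kxe := ler_wpM2r x0 ke; have kye := ler_wpM2r y0 ke.
have xye := ler_wpM2r y0 (le_trans xk ke).
have ex2 : `|expR x| <= 2.
  rewrite [expR x](_ : _ = (expR x - 1 - x) + (1 + x)); last by ring.
  apply: le_trans (ler_normD _ _) _.
  have := ler_normD 1 x; rewrite normr1; lra.
have ex1 : `|expR x - 1| <= 2 * `|x|.
  rewrite [expR x - 1](_ : _ = (expR x - 1 - x) + x); last by ring.
  apply: le_trans (ler_normD _ _) _; nra.
apply: le_trans (modulus_le_ReIm _) _ => /=.
have -> : expR x * cos y - 1 - x = (expR x - 1 - x) + expR x * (cos y - 1) by ring.
have -> : expR x * sin y - 0 - y = expR x * (sin y - y) + (expR x - 1) * y by ring.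
apply: le_trans (lerD (ler_normD _ _) (ler_normD _ _)) _.
rewrite !normrM.
have H2 := ler_pM (normr_ge0 _) (normr_ge0 _) ex2 E2.
have H3 := ler_pM (normr_ge0 _) (normr_ge0 _) ex2 E3.
have H4 := ler_wpM2r y0 ex1.
have -> : e * (`|x| + `|y|) = 6 * (e / 6 * `|x|) + 6 * (e / 6 * `|y|) by field.
have : 0 <= e / 6 * `|x| by apply: mulr_ge0 => //; lra.
have : 0 <= e / 6 * `|y| by apply: mulr_ge0 => //; lra.
clear -E1 H2 H3 H4 kxe kye xye x0 y0.
lra.
Qed.

(** [polar] is its own derivative with respect to the complex variable [s + i
    t]; by [polarD] it is enough to expand it at the origin. *)
Lemma polar_expansion s t e : 0 < e -> exists2 d, 0 < d &
  forall x y, `|x - s| <= d -> `|y - t| <= d ->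
    modulus (polar x y - polar s t - polar s t * ((x - s) +i* (y - t))%C)
      <= e * (`|x - s| + `|y - t|).
Proof.
move=> e0; have [d d0 H] := polar_expansion_at0 (divr_gt0 e0 (expR_gt0 s)).
exists d => // x y xs yt.
rewrite -{1}(subrKC s x) -{1}(subrKC t y) polarD.
have -> (p q z : R[i]) : p * q - p - p * z = p * (q - 1 - z) by ring.
rewrite modulusM modulus_polar mulrC -ler_pdivlMr ?expR_gt0 // mulrAC.
exact: H.
Qed.

(** In logarithmic polar coordinates around [a], the imaginary part of [q]
    times [ds + i dt] is the form [Im q ds + Re q dt], and the equality of its
    mixed derivatives is one of the Cauchy-Riemann equations. *)
Lemma polar_closed (q : R[i] -> R[i]) a s t A : cderiv q (a + polar s t) A ->
  closed_at (fun s t => complex.Im (q (a + polar s t)))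
            (fun s t => complex.Re (q (a + polar s t))) s t.
Proof.
move=> qA; set D := A * polar s t.
exists (complex.Re D), (complex.Im D), (- complex.Im D) => e e0.
have es := expR_gt0 s.
have A0 : 0 < modulus A + 1 by rewrite ltr_wpDl ?modulus_ge0.
pose e1 := Num.min (expR s) (e / (2 * (modulus A + 1))).
have e10 : 0 < e1 by rewrite lt_min es divr_gt0 // mulr_gt0.
have e1s : e1 <= expR s by rewrite ge_min lexx.
have e1A : (modulus A + 1) * e1 <= e / 2.
  rewrite mulrC -ler_pdivlMr // -mulrA -invfM mulrC.
  by rewrite ge_min; apply/orP; right; rewrite mulrC lexx.
have e20 : 0 < e / (4 * expR s) by rewrite divr_gt0 // mulr_gt0.
clearbody e1.
have [d1 d10 H1] := polar_expansion s t e10.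
have [d2 d20 H2] := qA _ e20.
exists (Num.min d1 (d2 / (4 * expR s))); first by rewrite lt_min d10 divr_gt0 ?mulr_gt0.
move=> x y; rewrite !le_min => /andP[xs1 xs2] /andP[yt1 yt2].
set N := `|x - s| + `|y - t|; set Dl := ((x - s) +i* (y - t))%C.
have N0 : 0 <= N by rewrite addr_ge0.
have DlN : modulus Dl <= N by exact: modulus_le_ReIm.
have {H1} H1 := H1 x y xs1 yt1.
have g2 : modulus (polar x y - polar s t) <= 2 * expR s * N.
  rewrite -[polar x y - polar s t](subrK (polar s t * Dl)).
  apply: le_trans (modulusD _ _) _; rewrite modulusM modulus_polar.
  have := ler_wpM2l (ltW es) DlN; have := ler_wpM2r N0 e1s; rewrite -/N -/Dl in H1 *.
  nra.
have gd2 : modulus (polar x y - polar s t) <= d2.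
  apply: le_trans g2 _.
  move: xs2 yt2; rewrite !ler_pdivlMr ?mulr_gt0 //; rewrite /N; nra.
have key : modulus (q (a + polar x y) - q (a + polar s t) - D * Dl) <= e * N.
  have := H2 (a + polar x y).
  have -> : a + polar x y - (a + polar s t) = polar x y - polar s t by ring.
  move=> /(_ gd2) H3.
  have -> : q (a + polar x y) - q (a + polar s t) - D * Dl =
     (q (a + polar x y) - q (a + polar s t) - A * (polar x y - polar s t)) +
     A * (polar x y - polar s t - polar s t * Dl) by rewrite /D; ring.
  apply: le_trans (modulusD _ _) _; rewrite modulusM.
  have K1 : e / (4 * expR s) * modulus (polar x y - polar s t) <= e / 2 * N.
    apply: le_trans (ler_wpM2l (ltW e20) g2) _.
    by rewrite le_eqVlt; apply/orP; left; apply/eqP; field; rewrite gt_eqF.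
  have K2 : modulus A * modulus (polar x y - polar s t - polar s t * Dl) <= e / 2 * N.
    apply: le_trans (ler_wpM2l (modulus_ge0 A) H1) _; rewrite mulrA -/N.
    by apply: ler_wpM2r => //; apply: le_trans e1A; rewrite ler_wpM2r ?(ltW e10) // lerDl.
  have -> : e * N = e / 2 * N + e / 2 * N by field.
  apply: lerD K2; exact: le_trans H3 K1.
split.
  apply: le_trans key; apply: le_trans (Im_le_modulus _).
  case: (q (a + polar x y)) => u1 v1; case: (q (a + polar s t)) => u2 v2.
  rewrite /Dl; case: (D) => u3 v3 /=.
  by rewrite le_eqVlt; apply/orP; left; apply/eqP; congr `|_|; ring.
apply: le_trans key; apply: le_trans (Re_le_modulus _).
case: (q (a + polar x y)) => u1 v1; case: (q (a + polar s t)) => u2 v2.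
rewrite /Dl; case: (D) => u3 v3 /=.
by rewrite le_eqVlt; apply/orP; left; apply/eqP; congr `|_|; ring.
Qed.

Definition ccont (q : R[i] -> R[i]) a := forall e : R, 0 < e ->
  exists2 r : R, 0 < r & forall w, modulus (w - a) <= r -> modulus (q w - q a) <= e.

(** [goursat] on the rectangle [s, ln r] x [0, 2 * pi]: the horizontal sides
    cancel by periodicity, so the integral over the circle of radius [expR s]
    does not depend on [s]; let [s] go to -oo. Since [polar] never vanishes,
    [a] only enters as this limit, so functions with a continuous extension
    across an isolated singularity are covered. *)
Lemma mean_value (q : R[i] -> R[i]) a r : 0 < r -> ccont q a ->
    (forall w, 0 < modulus (w - a) <= r -> exists A, cderiv q w A) ->
  itv_int (fun t => complex.Re (q (circle_point a r t))) 0 (2 * pi) =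
  complex.Re (q a) * (2 * pi).
Proof.
move=> r0 qa qd; have pi0 : 0 < 2 * pi :> R by rewrite mulr_gt0 // pi_gt0.
pose U s t := complex.Re (q (a + polar s t));
  pose V s t := complex.Im (q (a + polar s t)).
have clo s t : s <= ln r -> closed_at V U s t.
  move=> sr; have [|A qA] := qd (a + polar s t); last exact: polar_closed qA.
  by rewrite addrC addKr modulus_polar expR_gt0 -[r]lnK // ler_expR.
have const s : s <= ln r -> itv_int (U (ln r)) 0 (2 * pi) = itv_int (U s) 0 (2 * pi).
  move=> sr.
  have /(_ _ _ _) := @goursat R V U s 0 (ln r - s) (2 * pi).
  rewrite /rect_int subrKC add0r.
  have -> : V^~ (2 * pi) = V^~ 0.
    apply/funext => x; rewrite /V /polar.
    have -> : 2 * pi = pi *+ 2 :> R by rewrite mulr_natl.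
    by rewrite cos2pi sin2pi cos0 sin0.
  rewrite subrr add0r => H; apply/eqP; rewrite -subr_eq0; apply/eqP; apply: H.
  - by rewrite subr_ge0.
  - exact: ltW.
  - by move=> x y /andP[_ xs] _; apply: clo; rewrite subrKC in xs.
rewrite (eq_itv_int (g := U (ln r))) => [|t _]; last by rewrite /U circle_point_polar.
apply/eqP; rewrite -subr_eq0 -normr_le0; apply/ler_addgt0Pr => e e0; rewrite add0r.
have [d d0 H] := qa _ (divr_gt0 e0 pi0).
pose s := Num.min (ln r) (ln d).
have sr : s <= ln r by rewrite ge_min lexx.
rewrite (const s sr) -[X in _ <= X](divfK (lt0r_neq0 pi0)).
rewrite -[X in complex.Re _ * X]subr0 -[X in _ <= _ * X]subr0;
  apply: itv_int_near_cst; first exact: ltW.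
  by move=> t _; have [] := closed_at_continuous (clo s t sr).
move=> t _; apply: le_trans (H (a + polar s t) _).
  rewrite /U; case: (q _) => u1 v1; case: (q a) => u2 v2.
  exact: (Re_le_modulus ((u1 - u2) +i* (v1 - v2))%C).
by rewrite addrC addKr modulus_polar -[d]lnK // ler_expR ge_min lexx orbT.
Qed.
End mean_value.

(** * The maximum principle *)

Section max_principle.
Context {R : realType}.
Implicit Types (w z a : R[i]) (s t x y r e : R).

Lemma lt_le_real (u v : \bar R) : (u < v)%E -> exists c : R, (u < c%:E)%E /\
  (c%:E <= v)%E.
Proof.
case: u v => [u| |] [v| |] //=.
- by move=> uv; exists v.
- by move=> _; exists (u + 1); rewrite lte_fin ltrDl ltr01 leey.
- by move=> _; exists v; rewrite ltNyr.
- by move=> _; exists 0; rewrite ltNyr leey.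
Qed.

Lemma usc_compact_max (T : topologicalType) (K : set T) (W : T -> \bar R) :
  compact K -> K !=set0 -> usc_on K W -> exists2 p, K p & forall q, K q -> (W q <= W p)%E.
Proof.
move=> cK [k0 Kk0] uW.
pose S (y : T) := [set x : T | K x /\ (W y <= W x)%E].
have FF : ProperFilter (filter_from K S).
  apply: filter_from_proper; last by move=> y Ky; exists y.
  apply: filter_from_filter; first by exists k0.
  move=> y z Ky Kz; case: (leP (W y) (W z)) => [yz|/ltW zy].
    by exists z => // x [Kx zx]; split; split=> //; exact: le_trans zx.
  by exists y => // x [Kx zx]; split; split=> //; exact: le_trans zx.
have [|p [Kp clp]] := cK _ FF; first by exists k0 => // x [].
exists p => // y Ky; rewrite leNgt; apply/negP => /lt_le_real[c [pc cy]].
have FS : filter_from K S (S y) by exists y.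
have [x [[Kx yx] /(_ Kx) xc]] := clp _ _ FS (uW p Kp c pc).
by have := le_lt_trans (le_trans cy yx) xc; rewrite ltxx.
Qed.

Lemma modulus_triangle w z : `|modulus w - modulus z| <= modulus (w - z).
Proof.
rewrite ler_norml; apply/andP; split.
  by rewrite lerNl opprB lerBlDl -{1}[z](subrK w) (modulus_distC w) addrC modulusD.
by rewrite lerBlDl -{1}[w](subrK z) addrC modulusD.
Qed.

Lemma compact_disc r : compact ([set w | modulus w <= r] : set R[i]^o).
Proof.
pose f (p : R * R) : R[i]^o := (p.1 +i* p.2)%C.
have cf : continuous f.
  move=> [x y] A /nbhs_modulus[e e0 H]; apply/nbhs_ballP; exists (e / 2) => /=.
    by rewrite divr_gt0.
  move=> [x' y'] [/= xx yy]; apply: H.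
  apply: le_lt_trans (modulus_le_ReIm _) _; rewrite /= distrC (distrC y').
  by rewrite [e]splitr; apply: ltrD.
have cI : compact (f @` (`[- r, r] `*` `[- r, r])).
  apply: continuous_compact; first by apply: continuous_subspaceT.
  by apply: compact_setX; exact: segment_compact.
apply: subclosed_compact cI _.
  rewrite -openC openE => w /= /negP; rewrite -ltNge => rw.
  apply/nbhs_modulus; exists (modulus w - r); first by rewrite subr_gt0.
  move=> z zw /=; apply/negP; rewrite -ltNge.
  have := modulus_triangle w z; rewrite modulus_distC => /(le_trans (ler_norm _)).
  by move=> /le_lt_trans/(_ zw); lra.
move=> [x y] /= H; exists (x, y) => //=; rewrite !in_itv /= -!ler_norml.
by split; apply: le_trans H;
  [exact: (Re_le_modulus (x +i* y)%C)|exact: (Im_le_modulus (x +i* y)%C)].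
Qed.

Lemma modulus_sqr_circle a s t : modulus (circle_point a s t) ^+ 2 =
  modulus a ^+ 2 + s ^+ 2 + 2 * s * (complex.Re a * cos t + complex.Im a * sin t).
Proof.
rewrite !modulus_sqr /circle_point; case: a => x y /=.
rewrite [s ^+ 2 in RHS](_ : _ = s ^+ 2 * (cos t ^+ 2 + sin t ^+ 2)).
  by ring.
by rewrite cos2Dsin2 mulr1.
Qed.

Lemma itv_int_cos_sin (p q : R) :
  itv_int (fun t => p * cos t + q * sin t) 0 (2 * pi) = 0.
Proof.
pose g t := p * cos t + q * sin t.
have cg : continuous g.
  move=> t; apply: cvgD; apply: cvgM; try exact: cvg_cst.
    exact: continuous_cos.
  exact: continuous_sin.
have /(itv_int_shift (pi_ge0 R) cg) : forall x, g (x + 2 * pi) = g x.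
  by move=> x; rewrite /g mulr_natl cosD2pi sinD2pi.
rewrite (eq_itv_int (g := fun x => -1 * g x)); last first.
  by move=> x _; rewrite /g cosDpi sinDpi; ring.
rewrite itv_intZ => [|x _]; last exact: cg.
by rewrite -/g => H; lra.
Qed.

(** A sub-mean value property tested against continuous majorants on the
    circle. Integrals of continuous functions are additive, while [V] itself
    may take the value [-oo]. *)
Definition upper_submean (V : R[i] -> \bar R) a s := forall G : R -> R, continuous G ->
  (forall t, (V (circle_point a s t) <= (G t)%:E)%E) ->
  (V a <= ((2 * pi)^-1 * itv_int G 0 (2 * pi))%:E)%E.

(** Otherwise [V + e * modulus ^+ 2] exceeds its boundary values for a small
    [e] and takes its maximum at an interior point [a]. The resulting majorant
    of [V] on a circle of radius [s] around [a] has mean [V a - e * s ^+ 2],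
    because [modulus ^+ 2] has mean [modulus a ^+ 2 + s ^+ 2]. *)
Lemma max_principle (V : R[i]^o -> \bar R) (r B : R) : 0 < r ->
    (forall w, modulus w <= r -> (V w < +oo)%E) ->
    usc_on ([set w | modulus w <= r] : set R[i]^o) V ->
    (forall w, modulus w = r -> (V w <= B%:E)%E) ->
    (forall a, modulus a < r -> (B%:E < V a)%E -> exists2 s, 0 < s &
      (forall w, modulus (w - a) <= s -> modulus w <= r) /\ upper_submean V a s) ->
  forall w, modulus w <= r -> (V w <= B%:E)%E.
Proof.
move=> r0 Vfin uV bV sub w0 w0r; rewrite leNgt; apply/negP => Bw0.
have real w : modulus w <= r -> (B%:E < V w)%E -> exists v, V w = v%:E.
  by move=> /Vfin; case: (V w) => // v; exists v.
have [v0 v0E] := real _ w0r Bw0.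
have Bv0 : B < v0 by rewrite -lte_fin -v0E.
have r20 : 0 < r ^+ 2 by rewrite exprn_gt0.
(* Half of the excess of [V w0] over [B] is left after subtracting [e * r ^+
   2]. *)
pose e := (v0 - B) / (2 * r ^+ 2).
have e0 : 0 < e by rewrite divr_gt0 ?subr_gt0 // mulr_gt0.
have er : e * r ^+ 2 = (v0 - B) / 2 by rewrite /e; field; rewrite gt_eqF.
clearbody e.
pose W w := (V w + (e * modulus w ^+ 2)%:E)%E.
have uW : usc_on ([set w | modulus w <= r] : set R[i]^o) W.
  move=> x xr c Wc.
  have [c' [Vc' c'c]] : exists c', (V x < c'%:E)%E /\ c' + e * modulus x ^+ 2 < c.
    move: Wc (Vfin x xr); rewrite /W; case: (V x) => [v| |] //.
      rewrite -EFinD lte_fin => vc _; exists ((v + (c - e * modulus x ^+ 2)) / 2).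
      by rewrite lte_fin; split; lra.
    by move=> _ _; exists (c - e * modulus x ^+ 2 - 1); rewrite ltNyr; split => //; lra.
  have cm : \forall y \near (x : R[i]^o), c' + e * modulus y ^+ 2 < c.
    pose d := c - (c' + e * modulus x ^+ 2).
    have d0 : 0 < d by rewrite subr_gt0.
    have m0 := modulus_ge0 x.
    have k0 : 0 < e * (2 * modulus x + 1) by rewrite mulr_gt0 // ltr_wpDl // mulr_ge0.
    apply/nbhs_modulus; exists (Num.min 1 (d / (e * (2 * modulus x + 1)))).
      by rewrite lt_min ltr01 divr_gt0.
    move=> y; rewrite lt_min => /andP[y1]; rewrite ltr_pdivlMr // => y2.
    have := modulus_triangle y x; rewrite ler_norml => /andP[_ t1].
    rewrite -(subrK (c' + e * modulus x ^+ 2) c) -/d.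
    have h1 : modulus y <= modulus x + modulus (y - x) by lra.
    have h2 := modulus_ge0 (y - x).
    have h3 : modulus y ^+ 2 <= (modulus x + modulus (y - x)) ^+ 2.
      by rewrite ler_pXn2r // ?nnegrE ?modulus_ge0 // addr_ge0.
    have h4 : (modulus x + modulus (y - x)) ^+ 2 <= modulus x ^+ 2 + (2 *
      modulus x + 1) * modulus (y - x).
      nra.
    have h5 := ler_wpM2l (ltW e0) (le_trans h3 h4).
    lra.
  apply: (filterS2 _ _ (uV x xr c' Vc') cm) => y Vy cy yr.
  rewrite /W; apply: (@lt_trans _ _ (c'%:E + (e * modulus y ^+ 2)%:E)%E).
    by rewrite lteD2rE //; exact: Vy.
  by rewrite -EFinD lte_fin.
have [|a /= ar aW] := usc_compact_max (compact_disc (r := r)) _ uW; first by exists w0.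
have ea : e * modulus a ^+ 2 <= e * r ^+ 2.
  by rewrite ler_pM2l // ler_pXn2r // ?nnegrE ?modulus_ge0 // ltW.
have e0w : 0 <= e * modulus w0 ^+ 2 by rewrite mulr_ge0 ?exprn_ge0 ?modulus_ge0 // ltW.
have [va vaE] : exists va, V a = va%:E.
  have := aW _ w0r; have := Vfin a ar; rewrite /W v0E.
  by case: (V a) => [v _ _| |] //; exists v.
have vaB : B < va.
  have := aW _ w0r; rewrite /W v0E vaE -!EFinD lee_fin; lra.
have {}ar : modulus a < r.
  rewrite lt_neqAle ar andbT; apply/eqP => /bV.
  by rewrite vaE lee_fin leNgt vaB.
have [|s s0 [asr sm]] := sub a ar; first by rewrite vaE lte_fin.
pose G t := (va - e * s ^+ 2) + ((- (2 * e * s * complex.Re a)) * cos t +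
  (- (2 * e * s * complex.Im a)) * sin t).
have ccs (p q : R) : continuous (fun t : R => p * cos t + q * sin t).
  move=> t; apply: cvgD; apply: cvgM; try exact: cvg_cst.
    exact: continuous_cos.
  exact: continuous_sin.
have cG : continuous G by move=> t; apply: cvgD; [exact: cvg_cst|exact: ccs].
have pi0 : 0 < 2 * pi :> R by rewrite mulr_gt0 // pi_gt0.
have := sm G cG; rewrite vaE lee_fin /G itv_intD; last 2 first.
- by move=> t _; exact: cvg_cst.
- by move=> t _; exact: ccs.
rewrite itv_int_cos_sin addr0 itv_int_cst ?(ltW pi0) // subr0.
rewrite [_ * (2 * pi)]mulrC mulKf ?gt_eqF //.
have es : 0 < e * s ^+ 2 by rewrite mulr_gt0 // exprn_gt0.
suff H : forall t, (V (circle_point a s t) <= (G t)%:E)%E by move=> /(_ H); lra.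
move=> t; have ctr : modulus (circle_point a s t) <= r.
  by apply: asr; rewrite modulus_circle_point.
have := aW _ ctr; rewrite /W vaE modulus_sqr_circle.
case: (V _) (Vfin _ ctr) => [v _| |] //; last by move=> *; rewrite leNye.
by rewrite -!EFinD !lee_fin /G; lra.
Qed.
End max_principle.

(** * Logarithms and subharmonic functions on circles *)

Section circle_log.
Context {R : realType}.
Implicit Types (w z a : R[i]) (s t x y r e : R).

Lemma exists_angle x y : exists th, x = Num.sqrt (x ^+ 2 + y ^+ 2) * cos th /\
  y = Num.sqrt (x ^+ 2 + y ^+ 2) * sin th.
Proof.
set r := Num.sqrt _; have r2 : r ^+ 2 = x ^+ 2 + y ^+ 2.
  by rewrite sqr_sqrtr // addr_ge0 // sqr_ge0.
have r0 : 0 <= r by exact: sqrtr_ge0.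
have [rz|rz] := eqVneq r 0.
  exists 0; move: r2; rewrite rz expr0n !mul0r => /esym/eqP.
  by rewrite paddr_eq0 ?sqr_ge0 // !sqrf_eq0 => /andP[/eqP-> /eqP->].
have {}r0 : 0 < r by rewrite lt_def rz.
have xr : - 1 <= x / r <= 1.
  rewrite -ler_norml normrM normfV (gtr0_norm r0) ler_pdivrMr // mul1r.
  rewrite -(@ler_pXn2r _ 2) ?nnegrE ?normr_ge0 ?(ltW r0) //.
  by rewrite real_normK ?num_real // r2 lerDl sqr_ge0.
have sE : Num.sqrt (1 - (x / r) ^+ 2) = `|y| / r.
  have -> : 1 - (x / r) ^+ 2 = (y / r) ^+ 2.
    by rewrite !exprMn (_ : y ^+ 2 = r ^+ 2 - x ^+ 2); [field|rewrite r2; ring].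
  by rewrite sqrtr_sqr normrM normfV (gtr0_norm r0).
have cE : x = r * cos (acos (x / r)) by rewrite acosK ?in_itv //= mulrC divfK.
have [y0|y0] := lerP 0 y.
  by exists (acos (x / r)); rewrite sin_acos // sE ger0_norm // (mulrC r (_ / _)) divfK.
exists (- acos (x / r)); rewrite cosN sinN sin_acos // sE ltr0_norm //.
by rewrite mulNr opprK (mulrC r (_ / _)) divfK.
Qed.

Lemma modulus_circle_angle a : exists th, forall s t,
  modulus (circle_point a s t) ^+ 2 =
  modulus a ^+ 2 + s ^+ 2 - 2 * s * modulus a * cos (1%:R * t + th).
Proof.
have [th [aR aI]] := exists_angle (complex.Re a) (complex.Im a).
have mE : Num.sqrt (complex.Re a ^+ 2 + complex.Im a ^+ 2) = modulus a.
  by case: a {th aR aI}.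
exists (- th + pi) => s t; rewrite modulus_sqr_circle addrA cosDpi mul1r cosD cosN sinN.
rewrite {1}aR mE {1}aI mE; ring.
Qed.

(** The superharmonic half of the harmonicity of [ln \o modulus] away from the
    origin; it is the half needed to divide by a power of the modulus. *)
Lemma mean_ln_modulus_le a s : 0 < s < modulus a ->
  itv_int (fun t => ln (modulus (circle_point a s t))) 0 (2 * pi) <=
  ln (modulus a) * (2 * pi).
Proof.
move=> /andP[s0 sa]; have [th thE] := modulus_circle_angle a.
have a0 : 0 < modulus a by exact: lt_trans sa.
have pi0 : 0 < 2 * pi :> R by rewrite mulr_gt0 // pi_gt0.
have rho1 : 0 <= s / modulus a < 1.
  by rewrite divr_ge0 ?(ltW s0) ?(ltW a0) //= ltr_pdivrMr // mul1r.
set rho := s / modulus a in rho1.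
have sE : s = rho * modulus a by rewrite divfK // gt_eqF.
have rr : 2 * rho < 1 + rho ^+ 2 by nra.
have r0 : 0 <= 2 * rho by case/andP: rho1 => ? _; rewrite mulr_ge0.
have clc := @continuous_log_cos R _ _ 1 th r0 rr.
rewrite (eq_itv_int (g := fun t => ln (modulus a) + 2^-1 * log_cos (1 + rho ^+
  2) (2 * rho) 1 th t)).
  rewrite itv_intD; last 2 first.
  - by move=> t _; exact: cvg_cst.
  - by move=> t _; apply: cvgM; [exact: cvg_cst|exact: clc].
  rewrite itv_int_cst ?(ltW pi0) // subr0 itv_intZ; last by move=> t _; exact: clc.
  rewrite -[leRHS]addr0 lerD2l pmulr_rle0 ?invr_gt0 //.
  exact: log_cos_int_le0.
move=> t _; rewrite /log_cos.
have L0 := log_cos_arg_gt0 (1%:R * t + th) r0 rr.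
have cE : modulus (circle_point a s t) ^+ 2 = modulus a ^+ 2 *
    (1 + rho ^+ 2 - 2 * rho * cos (1%:R * t + th)).
  by rewrite thE {1 2}sE; ring.
have c0 : 0 < modulus (circle_point a s t).
  rewrite lt_def modulus_ge0 andbT; apply/eqP => ceq.
  have : 0 < modulus (circle_point a s t) ^+ 2 by rewrite cE mulr_gt0 // exprn_gt0.
  by rewrite ceq expr0n ltxx.
have : ln (modulus (circle_point a s t) ^+ 2) = ln (modulus a ^+ 2 *
    (1 + rho ^+ 2 - 2 * rho * cos (1%:R * t + th))) by rewrite cE.
rewrite lnM ?posrE ?exprn_gt0 // !lnXn //.
rewrite -[ln (modulus a) *+ 2]mulr_natl -[ln _ *+ 2]mulr_natl.
by move=> H; lra.
Qed.

Lemma continuous_circle_point a s : continuous (circle_point a s).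
Proof.
move=> t A /nbhs_modulus[e e0 H].
have cE : \forall t' \near t, `|s * cos t - s * cos t'| < e / 2.
  have /cvgrPdist_lt : (s * cos t' @[t' --> t] --> s * cos t).
    by apply: cvgM; [exact: cvg_cst|exact: continuous_cos].
  by apply; rewrite divr_gt0.
have sE : \forall t' \near t, `|s * sin t - s * sin t'| < e / 2.
  have /cvgrPdist_lt : (s * sin t' @[t' --> t] --> s * sin t).
    by apply: cvgM; [exact: cvg_cst|exact: continuous_sin].
  by apply; rewrite divr_gt0.
apply: filterS2 cE sE => t' ct st; apply: H.
apply: le_lt_trans (modulus_le_ReIm _) _.
rewrite [e]splitr /circle_point; case: a => x y /=.
have -> : x + s * cos t' - (x + s * cos t) = - (s * cos t - s * cos t') by ring.
have -> : y + s * sin t' - (y + s * sin t) = - (s * sin t - s * sin t') by ring.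
by rewrite !normrN; exact: ltrD.
Qed.
End circle_log.

Section integral_monotone.
Context d (T : measurableType d) (R : realType) (mu : {measure set T -> \bar R}).
Local Open Scope ereal_scope.

(** Monotonicity without integrability: the integral of [f] may be [-oo]. *)
Lemma le_integral_measurable (D : set T) (f g : T -> \bar R) : measurable D ->
    measurable_fun D f -> measurable_fun D g -> (forall x, D x -> f x <= g x) ->
  \int[mu]_(x in D) f x <= \int[mu]_(x in D) g x.
Proof.
move=> mD mf mg fg; rewrite [leLHS]integralE [leRHS]integralE; apply: leeB.
  apply: ge0_le_integral => //; try exact: measurable_funepos.
  by move=> x Dx; apply: (@funepos_le _ _ D); [move=> y /set_mem;
    exact: fg|exact: mem_set].
apply: ge0_le_integral => //; try exact: measurable_funeneg.
by move=> x Dx; apply: (@funeneg_le _ _ D); [move=> y /set_mem; exact: fg|exact: mem_set].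
Qed.
End integral_monotone.

Section circle_subharmonic.
Context {R : realType}.
Implicit Types (a : R[i]) (s t x y r e : R).

Lemma usc_circle_measurable (U : set R[i]^o) (v : R[i]^o -> \bar R) a s :
    usc_on U v -> (forall t, U (circle_point a s t)) ->
  measurable_fun setT (fun t => v (circle_point a s t)).
Proof.
move=> uv Uc.
have lsc : @lower_semicontinuous R R (fun t => - v (circle_point a s t))%E.
  move=> t c ct.
  have vt : (v (circle_point a s t) < (- c)%:E)%E by rewrite EFinN lteNr.
  exists [set t' | (c%:E < - v (circle_point a s t'))%E] => //.
  have cc : \forall t' \near t, U (circle_point a s t') ->
      (v (circle_point a s t') < (- c)%:E)%E.
    exact: continuous_circle_point (uv _ (Uc t) _ vt).
  by apply: filterS cc => t' /(_ (Uc t')) /=; rewrite EFinN lteNr.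
have mf := lower_semicontinuous_measurable lsc.
have := measurableT_comp (@oppe_measurable R setT) mf.
by apply: eq_measurable_fun => t _ /=; rewrite oppeK.
Qed.

Lemma subharmonic_upper_submean (U : set R[i]^o) (v : R[i]^o -> \bar R) a s :
    subharmonic_on U v -> 0 < s -> (forall w, modulus (w - a) <= s -> U w) ->
  upper_submean v a s.
Proof.
move=> [vfin uv sm] s0 sU G cG vG.
have Uc t : U (circle_point a s t) by apply: sU; rewrite modulus_circle_point.
apply: le_trans (sm a s s0 sU) _.
have pi0 : 0 < 2 * pi :> R by rewrite mulr_gt0 // pi_gt0.
rewrite EFinM lee_pmul2l ?lte_fin ?invr_gt0 //.
have cGo : cont_on G 0 (2 * pi) by move=> x _; exact: cG.
rewrite /itv_int /Rintegral fineK; last first.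
  by apply: integrable_fin_num => //; exact: cont_on_integrable.
apply: le_integral_measurable => //.
- by apply: measurable_funTS; exact: usc_circle_measurable uv Uc.
- by have /measurable_int := cont_on_integrable cGo.
Qed.
End circle_subharmonic.

(** * Schwarz lemma for holomorphic functions *)

Section schwarz.
Context {R : realType}.
Implicit Types (w z a : R[i]) (s t x y r e : R).

Lemma disc_in_disc a r w : modulus (w - a) <= r - modulus a -> modulus w <= r.
Proof. by have := modulusD (w - a) a; rewrite subrK; lra. Qed.

Lemma le_div_of_radius (X Y m rho : R) : 0 <= Y -> 0 <= m -> m < rho ->
  (forall r, m < r < rho -> X <= Y / r) -> X <= Y / rho.
Proof.
move=> Y0 m0 mr H; have rho0 : 0 < rho by exact: le_lt_trans mr.
rewrite ler_pdivlMr // leNgt; apply/negP => YX.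
have X0 : 0 < X by rewrite -(pmulr_lgt0 _ rho0) (le_lt_trans Y0).
pose b := Num.max m (Y / X).
have brho : b < rho by rewrite gt_max mr ltr_pdivrMr // mulrC.
have mb : m <= b by rewrite le_max lexx.
have YXb : Y / X <= b by rewrite le_max lexx orbT.
have r0 : 0 < (b + rho) / 2 by lra.
have : X <= Y / ((b + rho) / 2) by apply: H; lra.
rewrite ler_pdivlMr //; apply/negP; rewrite -ltNge mulrC -ltr_pdivrMr //; lra.
Qed.

Lemma cderiv_ccont (q : R[i] -> R[i]) a A : cderiv q a A -> ccont q a.
Proof.
move=> qA e e0; have [r r0 H] := qA 1 ltr01.
have A0 : 0 < modulus A + 1 by rewrite ltr_wpDl ?modulus_ge0.
exists (Num.min r (e / (modulus A + 1))); first by rewrite lt_min r0 divr_gt0.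
move=> w; rewrite le_min ler_pdivlMr // => /andP[/H wr we].
rewrite -[q w - q a](subrK (A * (w - a))).
apply: le_trans (modulusD _ _) _; rewrite modulusM.
by rewrite mul1r in wr; lra.
Qed.

Lemma ccont_usc (q : R[i] -> R[i]) a (c : R) : ccont q a -> modulus (q a) < c ->
  \forall w \near (a : R[i]^o), modulus (q w) < c.
Proof.
move=> qa ac; have e0 : 0 < (c - modulus (q a)) / 2 by rewrite divr_gt0 // subr_gt0.
have [r r0 H] := qa _ e0; apply/nbhs_modulus; exists r => // w /ltW/H wr.
have := modulus_triangle (q w) (q a) => /(le_trans (ler_norm _)).
move: e0; lra.
Qed.

(** The expansion of [h w / w] is not read off at 0, so that [q 0] may be
    prescribed freely. *)
Lemma cderiv_quotient (q h : R[i] -> R[i]) a A (c : R[i]) : a != 0 ->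
    (forall w, w != 0 -> q w = c * (h w / w)) -> cderiv h a A ->
  exists D, cderiv q a D.
Proof.
move=> a0 qE hA; have m0 : 0 < modulus a by rewrite modulus_gt0.
exists (c * (A / a - h a / a ^+ 2)) => e e0.
set m := modulus a in m0.
pose K := modulus A / m + modulus (h a) / m ^+ 2.
have K0 : 0 <= K by rewrite addr_ge0 // divr_ge0 ?modulus_ge0 // ?exprn_ge0 // ltW.
have mc := modulus_ge0 c.
pose N := 2 * (modulus c + 1) / m.
have N0 : 0 < N by rewrite divr_gt0 // mulr_gt0 // ltr_wpDl.
have [r r0 H] := hA (e / (2 * N)) (divr_gt0 e0 (mulr_gt0 (ltr0Sn _ 1) N0)).
exists (Num.min (Num.min r (m / 2)) (e / (2 * N * (K + 1)))).
  have K1 : 0 < K + 1 by rewrite ltr_wpDl.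
  have q0 : 0 < e / (2 * N * (K + 1)).
    by apply: divr_gt0 => //; apply: mulr_gt0 => //; apply: mulr_gt0.
  by rewrite !lt_min r0 q0 divr_gt0.
move=> w; rewrite !le_min => /andP[/andP[wr wm]].
rewrite ler_pdivlMr; last by apply: mulr_gt0; [exact: mulr_gt0|rewrite ltr_wpDl].
move=> wK; have {H} H := H w wr.
have w2 : m / 2 <= modulus w.
  by have := modulusD (w - a) (- w); rewrite addrAC subrr sub0r !modulusN -/m; lra.
have w0 : w != 0 by rewrite -modulus_gt0 (lt_le_trans _ w2) // divr_gt0.
have mw0 : 0 < modulus w by rewrite modulus_gt0.
have wV : (modulus w)^-1 <= 2 / m.
  by rewrite -[2 / m]invf_div lef_pV2 ?posrE // divr_gt0.
rewrite (qE w w0) (qE a a0).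
have -> : c * (h w / w) - c * (h a / a) - c * (A / a - h a / a ^+ 2) * (w - a) =
  c * (w^-1 * ((h w - h a - A * (w - a)) - (A / a - h a / a ^+ 2) * (w - a) ^+ 2)).
  by field; rewrite a0 w0.
set E := _ - A * _ in H *; set Dl := modulus (w - a) in wr wm wK H *.
have Dl0 : 0 <= Dl by exact: modulus_ge0.
have AK : modulus (A / a - h a / a ^+ 2) <= K.
  by apply: le_trans (modulusD _ _) _; rewrite modulusN !modulusM !modulusV modulusX.
have B1 : modulus (E - (A / a - h a / a ^+ 2) * (w - a) ^+ 2) <=
    e / (2 * N) * Dl + K * Dl ^+ 2.
  apply: le_trans (modulusD _ _) _; rewrite modulusN modulusM modulusX -/Dl.
  by apply: lerD => //; apply: ler_wpM2r => //; exact: exprn_ge0.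
rewrite !modulusM modulusV.
have B2 : modulus c * (modulus w)^-1 <= N.
  apply: le_trans (ler_wpM2l mc wV) _; rewrite /N mulrCA -mulrA ler_pM2l //.
  by rewrite ler_wpM2r ?invr_ge0 ?(ltW m0) // lerDl.
rewrite mulrA; apply: le_trans (ler_pM _ (modulus_ge0 _) B2 B1) _.
  by rewrite mulr_ge0 // invr_ge0 modulus_ge0.
have -> : N * (e / (2 * N) * Dl + K * Dl ^+ 2) = e / 2 * Dl + N * K * Dl * Dl.
  by field; rewrite gt_eqF.
have : N * K * Dl <= e / 2 by have := mulr_ge0 (ltW N0) Dl0; nra.
by move=> /(ler_wpM2r Dl0); lra.
Qed.

(** The maximum principle on the disc of radius [r] for the modulus of [q w = h
    w / w], [q 0 = h' 0], bounded by [M / r] on the boundary; then [r] tends to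
    [rho]. The sub-mean value property at [a] is [mean_value] for [q] rotated
    so that its value at [a] is nonnegative. *)
Lemma holomorphic_schwarz (h : R[i] -> R[i]) (M rho : R) :
    (forall w, modulus w < rho -> modulus (h w) <= M) -> h 0 = 0 ->
    (forall w, modulus w < rho -> exists A, cderiv h w A) ->
  forall w, modulus w < rho -> modulus (h w) <= M * modulus w / rho.
Proof.
move=> hM h0 hd w wrho.
have rho0 : 0 < rho by apply: le_lt_trans wrho; exact: modulus_ge0.
have M0 : 0 <= M by apply: le_trans (modulus_ge0 _) (hM 0 _); rewrite modulus0.
apply: (le_div_of_radius _ (modulus_ge0 w)) => //; first by rewrite mulr_ge0 ?modulus_ge0.
move=> r /andP[wr rrho]; have r0 : 0 < r by apply: le_lt_trans wr; exact: modulus_ge0.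
have [A0 hA0] := hd 0 (eq_ind_r (fun x => x < rho) rho0 modulus0).
pose q z := if z == 0 then A0 else h z / z.
have [->|w0] := eqVneq w 0; first by rewrite h0 modulus0 mulr0 mul0r.
suff : ((modulus (q w))%:E <= (M / r)%:E)%E.
  rewrite lee_fin /q (negPf w0) modulusM modulusV ler_pdivrMr ?modulus_gt0 //.
  by rewrite mulrAC.
have qc0 : ccont q 0.
  move=> e e0; have [d d0 H] := hA0 e e0; exists d => // z /H.
  rewrite h0 !subr0 /q eqxx; have [->|z0] := eqVneq z 0.
    by rewrite subrr modulus0 => _; exact: ltW.
  have -> : h z - A0 * z = (h z / z - A0) * z by field.
  by rewrite modulusM ler_pM2r // modulus_gt0.
have qd a : a != 0 -> modulus a < rho -> exists D, cderiv q a D.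
  move=> a0 /hd[A hA]; apply: (@cderiv_quotient q h a A 1 a0 _ hA) => z z0.
  by rewrite /q (negPf z0) mul1r.
have qc a : modulus a < rho -> ccont q a.
  have [->//|a0 /(qd _ a0)[D]] := eqVneq a 0; exact: cderiv_ccont.
apply: (@max_principle _ (fun z => (modulus (q z))%:E) r) => //.
- by move=> z _; rewrite ltry.
- move=> a /= ar c; rewrite lte_fin => /(ccont_usc (qc a (le_lt_trans ar rrho))).
  by apply: filterS => z zc _; rewrite lte_fin.
- move=> z zr; have z0 : z != 0 by rewrite -modulus_gt0 zr.
  rewrite lee_fin /q (negPf z0) modulusM modulusV zr ler_pM2r ?invr_gt0 //.
  by apply: hM; rewrite zr.
- move=> a ar _.
  (* For [a != 0] the disc has to avoid the origin, where [q] is only known to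
     be continuous. *)
  pose s := if a == 0 then r else Num.min (r - modulus a) (modulus a / 2).
  have s0 : 0 < s.
    rewrite /s; have [//|a0] := eqVneq a 0.
    by rewrite lt_min subr_gt0 ar divr_gt0 // modulus_gt0.
  have sr : s <= r - modulus a.
    rewrite /s; have [->|a0] := eqVneq a 0; first by rewrite modulus0 subr0.
    by rewrite ge_min lexx.
  have pun z : 0 < modulus (z - a) <= s -> z != 0.
    rewrite /s; have [->|a0 /andP[_]] := eqVneq a 0.
      by rewrite subr0 modulus_gt0 => /andP[].
    rewrite le_min => /andP[_]; apply: contraTneq => ->.
    by rewrite sub0r modulusN -ltNge; have := modulus_gt0 a; rewrite a0; lra.
  exists s => //; split=> [z zs|G cG qG]; first by apply: (disc_in_disc (a := a)); lra.
  (* A unimodular constant with [c * q a = modulus (q a)]. *)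
  pose c : R[i] := if q a == 0 then 1 else (modulus (q a))%:C%C / q a.
  have c1 : modulus c = 1.
    rewrite /c; have [_|qa0] := eqVneq (q a) 0; first exact: modulus1.
    by rewrite modulusM modulusV modulus_real ger0_norm ?modulus_ge0 // divff
      // modulus_eq0.
  have cqa : complex.Re (c * q a) = modulus (q a).
    rewrite /c; have [->|qa0] := eqVneq (q a) 0; first by rewrite mulr0 modulus0.
    by rewrite divfK.
  have cqd z : z != 0 -> modulus z < rho -> exists D, cderiv (fun z => c * q z) z D.
    move=> z0 /hd[A hA].
    apply: (@cderiv_quotient (fun z => c * q z) h z A c z0 _ hA) => x x0.
    by rewrite /q (negPf x0).
  have cqc : ccont (fun z => c * q z) a.
    move=> e e0; have [d d0 H] := qc a (lt_trans ar rrho) e e0.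
    by exists d => // z /H; rewrite -mulrBr modulusM c1 mul1r.
  have disc z : modulus (z - a) <= s -> modulus z < rho.
    by move=> zs; apply: le_lt_trans rrho; apply: (disc_in_disc (a := a)); lra.
  have pi0 : 0 < 2 * pi :> R by rewrite mulr_gt0 // pi_gt0.
  have := @mean_value R (fun z => c * q z) a s s0 cqc _.
  rewrite cqa lee_fin => mv; rewrite mulrC ler_pdivlMr // -mv.
    apply: itv_int_le => [t _|t _|t _]; last 2 first.
    - exact: cG.
    - apply: le_trans (ler_norm _) (le_trans (Re_le_modulus _) _).
      by rewrite modulusM c1 mul1r -lee_fin.
    have ct : modulus (circle_point a s t - a) = s by exact: modulus_circle_point.
    have [||D Dd] := cqd (circle_point a s t).
    - by apply: pun; rewrite ct s0 lexx.
    - by apply: disc; rewrite ct.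
    have cc := cderiv_ccont Dd.
    move=> S /nbhs_ballP[e /= e0 HS].
    have [d d0 Hd] := cc (e / 2) (divr_gt0 e0 (ltr0Sn _ 1)).
    have nb : \forall z \near (circle_point a s t : R[i]^o),
        modulus (z - circle_point a s t) < d by apply/nbhs_modulus; exists d.
    have ct' : \forall t' \near t, modulus (circle_point a s t' - circle_point a s t) < d.
      exact: continuous_circle_point nb.
    apply: filterS ct' => t' /ltW /Hd H; apply: HS; rewrite -ball_normE /=.
    apply: (@le_lt_trans _ _ (e / 2)); last by lra.
    rewrite distrC; apply: le_trans H.
    by rewrite -raddfB; exact: Re_le_modulus.
  move=> z zs; apply: cqd; first exact: pun.
  by apply: disc; case/andP: zs.
- by exact: ltW.
Qed.
End schwarz.

(** * Schwarz lemma for log-subharmonic functions *)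

Section log_subharmonic_schwarz.
Context {R : realType}.
Implicit Types (w z a : R[i]) (s t x y r e : R).

Lemma lne_real x : lne x%:E = if 0 < x then (ln x)%:E else -oo%E.
Proof.
by case: ifPn => [/lne_EFin//|]; rewrite -leNgt => x0; rewrite le0_lneNy // lee_fin.
Qed.

Lemma lte_between (u : \bar R) (c : R) : (u < c%:E)%E ->
  exists c', (u < c'%:E)%E /\ c' < c.
Proof.
case: u => [u| |] //=; last by move=> _; exists (c - 1); rewrite ltNyr; split=> //; lra.
by rewrite lte_fin => uc; exists ((u + c) / 2); rewrite lte_fin; split; lra.
Qed.

Lemma le_of_scaled_le (X Z : R) : (forall th, 0 < th < 1 -> X <= th * Z) -> X <= Z.
Proof.
move=> H; apply/ler_addgt0Pr => e e0.
have z0 : 0 < `|Z| + 1 by rewrite ltr_wpDl.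
pose d := Num.min (1 / 2) (e / (`|Z| + 1)).
have d0 : 0 < d by rewrite lt_min !divr_gt0.
have d1 : d <= 1 / 2 by rewrite ge_min lexx.
have de : d * (`|Z| + 1) <= e by rewrite -ler_pdivlMr // ge_min lexx orbT.
clearbody d; have H1 : 0 < 1 - d < 1 by lra.
apply: le_trans (H _ H1) _; rewrite mulrBl mul1r lerD2l.
apply: le_trans de; rewrite -mulrN ler_pM2l //.
by rewrite (le_trans (ler_norm _)) // normrN lerDl.
Qed.

(** The maximum principle for [ln u - th * ln modulus] with [th < 1]. The
    hypothesis [u <= C * modulus] makes this function tend to [-oo] at 0, so it
    is upper semicontinuous there, and 0 is not among the points above the
    boundary bound. Then [th] tends to 1 and the radius to [rho]. *)
Lemma log_subharmonic_schwarz (U : set R[i]^o) (u : R[i]^o -> R) (M C rho : R) :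
    subharmonic_on U (fun w => lne (u w)%:E) ->
    (forall w, modulus w < rho -> U w) ->
    (forall w, modulus w < rho -> u w <= M) -> 0 < C ->
    (forall w, modulus w < rho -> 0 <= u w <= C * modulus w) ->
  forall w, modulus w < rho -> u w <= M * modulus w / rho.
Proof.
move=> su rU uM C0 uC w wrho; have [_ uscu _] := su.
have rho0 : 0 < rho by apply: le_lt_trans wrho; exact: modulus_ge0.
have m0w := modulus_ge0 w.
have M0 : 0 <= M.
  by have /andP[+ _] := uC _ wrho => /le_trans; apply; exact: uM.
have [uw|uw] := lerP (u w) 0.
  by apply: le_trans uw _; rewrite divr_ge0 ?mulr_ge0 // ltW.
have {M0} M0 : 0 < M by exact: lt_le_trans (uM _ wrho).
have w0 : 0 < modulus w.
  by have /andP[_ /(lt_le_trans uw)] := uC _ wrho; rewrite pmulr_rgt0.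
apply: (le_div_of_radius _ m0w) => //; first by rewrite mulr_ge0 // ltW.
move=> r /andP[wr rrho]; have r0 : 0 < r by exact: lt_trans wr.
rewrite -ler_ln ?posrE ?divr_gt0 ?mulr_gt0 // ln_div ?posrE ?mulr_gt0 // lnM ?posrE //.
suff : ln (u w) - ln M <= ln (modulus w) - ln r by lra.
apply: le_of_scaled_le => th /andP[th0 th1].
(* The value at 0 is the limit of the other branch. *)
pose V z : \bar R := if z == 0 then -oo%E else
  (lne (u z)%:E - (th * ln (modulus z))%:E)%E.
suff : (V w <= (ln M - th * ln r)%:E)%E.
  rewrite /V -modulus_eq0 gt_eqF // lne_real uw -EFinB lee_fin; lra.
apply: (@max_principle _ V r) => //; last exact: ltW.
- by move=> z _; rewrite /V; case: eqP => // _; rewrite lne_real;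
  case: ifP => //; rewrite -EFinB ltry.
- move=> x /= xr c Vc; have [x0|x0] := eqVneq x 0.
    (* On [modulus y < expR k] the bound [u <= C * modulus] gives [V y < c]. *)
    pose k := (c - ln C) / (1 - th).
    apply/nbhs_modulus; exists (expR k); first exact: expR_gt0.
    move=> y; rewrite x0 subr0 => yk yr.
    rewrite /V; case: eqVneq => [_|y0]; first by rewrite ltNyr.
    rewrite lne_real; case: ifPn => uy; last by rewrite addNye ltNyr.
    have my : 0 < modulus y by rewrite modulus_gt0.
    rewrite -EFinB lte_fin.
    have : ln (u y) <= ln C + ln (modulus y).
      rewrite -lnM ?posrE // ler_ln ?posrE ?mulr_gt0 //.
      by have /andP[] := uC y (le_lt_trans yr rrho).
    have : ln (modulus y) < k by rewrite -(expRK k) ltr_ln ?posrE ?expR_gt0.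
    rewrite /k ltr_pdivlMr ?subr_gt0 //; lra.
  have mx : 0 < modulus x by rewrite modulus_gt0.
  move: Vc; rewrite /V (negPf x0) lteBlDr // -EFinD => /lte_between[c1 [uc1 c1c]].
  (* Near [x], [modulus y > modulus x * expR (- g)], which is [c1 < c + th * ln
     (modulus y)]. *)
  pose g := (c + th * ln (modulus x) - c1) / th.
  have g0 : 0 < g by rewrite divr_gt0 // subr_gt0.
  have ng : \forall y \near (x : R[i]^o), modulus x * expR (- g) < modulus y.
    apply/nbhs_modulus; exists (modulus x * (1 - expR (- g))).
      by rewrite mulr_gt0 // subr_gt0 -expR0 ltr_expR oppr_lt0.
    move=> y yx; have := modulusD (x - y) y; rewrite subrK (modulus_distC x); lra.
  have Ux : U x by apply: rU; exact: le_lt_trans rrho.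
  apply: filterS2 ng (uscu x Ux c1 uc1) => y yg yc1 yr.
  have my : 0 < modulus y by apply: lt_trans yg; rewrite mulr_gt0 // expR_gt0.
  have Uy : U y by apply: rU; exact: le_lt_trans rrho.
  rewrite /V -modulus_eq0 gt_eqF // lteBlDr // -EFinD (lt_trans (yc1 Uy)) // lte_fin.
  have : ln (modulus x) - g < ln (modulus y).
    rewrite -{1}(expRK (- g)) -lnM ?posrE ?expR_gt0 //.
    by rewrite ltr_ln ?posrE // mulr_gt0 // expR_gt0.
  move=> gy; have : th * (ln (modulus x) - g) < th * ln (modulus y) by rewrite ltr_pM2l.
  by rewrite mulrBr /g [th * (_ / _)]mulrC divfK ?gt_eqF //; lra.
- move=> z zr; have zrho : modulus z < rho by rewrite zr.
  rewrite /V -modulus_eq0 zr gt_eqF // lne_real; case: ifPn => uz;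
    last by rewrite addNye leNye.
  by rewrite -EFinB lee_fin lerD2r ler_ln ?posrE //; exact: uM.
- move=> a ar Va; have a0 : a != 0.
    by apply/eqP => a0; move: Va; rewrite /V a0 eqxx ltNge leNye.
  have ma : 0 < modulus a by rewrite modulus_gt0.
  pose s := Num.min (r - modulus a) (modulus a / 2).
  have s0 : 0 < s by rewrite lt_min subr_gt0 ar divr_gt0.
  have sr : s <= r - modulus a by rewrite ge_min lexx.
  have sa : s <= modulus a / 2 by rewrite ge_min lexx orbT.
  clearbody s.
  exists s => //; split=> [z zs|G cG VG]; first by apply: (disc_in_disc (a := a)); lra.
  have sU z : modulus (z - a) <= s -> U z.
    by move=> zs; apply: rU; apply: le_lt_trans rrho; apply: (disc_in_disc (a := a)); lra.
  have mc t : 0 < modulus (circle_point a s t).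
    have := modulusD (a - circle_point a s t) (circle_point a s t).
    by rewrite subrK modulus_distC modulus_circle_point //; lra.
  pose L t := ln (modulus (circle_point a s t)).
  have cL : continuous L.
    move=> t; apply: (@continuous_comp _ _ _ (fun t => modulus (circle_point a
      s t)) (@ln R)); last first.
      exact: continuous_ln.
    apply/cvgrPdist_lt => e e0.
    have nb : \forall z \near (circle_point a s t : R[i]^o),
        modulus (z - circle_point a s t) < e by apply/nbhs_modulus; exists e.
    have ct' : \forall t' \near t, modulus (circle_point a s t' - circle_point a s t) < e.
      exact: continuous_circle_point nb.
    apply: filterS ct' => t'; rewrite modulus_distC; apply: le_lt_trans.
    exact: modulus_triangle.
  have cH : continuous (fun t => G t + th * L t : R).
    move=> t; apply: cvgD; first exact: cG.
    by apply: cvgM; [exact: cvg_cst|exact: cL].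
  have := subharmonic_upper_submean su s0 sU cH.
  have pi0 : 0 < 2 * pi :> R by rewrite mulr_gt0 // pi_gt0.
  rewrite /V (negPf a0) leeBlDr // -EFinD => H.
  apply: le_trans (H _) _.
    move=> t; have := VG t; rewrite /V -modulus_eq0 gt_eqF //.
    by rewrite leeBlDr // -EFinD.
  rewrite itv_intD; last 2 first.
  - by move=> t _; exact: cG.
  - by move=> t _; apply: cvgM; [exact: cvg_cst|exact: cL].
  rewrite itv_intZ; last by move=> t _; exact: cL.
  rewrite lee_fin mulrDr lerD2l mulrC ler_pdivrMr // -mulrA ler_pM2l //.
  by apply: mean_ln_modulus_le; rewrite s0 /=; lra.
Qed.
End log_subharmonic_schwarz.

(** * Coordinate lines in the ball and the upper bound *)

Section upper_bound.
Context {R : realType} (n : nat).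
Implicit Types (w z X : 'Cn[R]_n) (l : R[i]).

Lemma unit_ballE w : unit_ball w <-> \sum_(j < n) modulus (w 0 j) ^+ 2 < 1.
Proof. by rewrite /unit_ball /= /enorm -[X in _ < X]sqrtr1 ltr_sqrt. Qed.

Lemma sum_split_at (d : nat) (F : 'I_n -> R) :
  \sum_(j < n) F j = \sum_(j < n | (j < d)%N) F j + \sum_(j < n | (d <= j)%N) F j.
Proof.
rewrite (bigID (fun j : 'I_n => (j < d)%N)) /=; congr (_ + _).
by apply: eq_bigl => j; rewrite -leqNgt.
Qed.

Lemma sum_from_split (F : 'I_n -> R) (i : 'I_n) :
  \sum_(j < n | (i <= j)%N) F j = F i + \sum_(j < n | (i < j)%N) F j.
Proof.
rewrite (bigD1 i) //=; congr (_ + _); apply: eq_bigl => j.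
by rewrite ltn_neqAle andbC eq_sym.
Qed.

(** The squared radius of the ball in the first [d] coordinates that remains
    when the others are those of [z]. *)
Definition tail_gap (d : nat) z : R := 1 - \sum_(j < n | (d <= j)%N) modulus (z 0 j) ^+ 2.

Lemma tail_gap_gt0 d z : unit_ball z -> 0 < tail_gap d z.
Proof.
rewrite unit_ballE (sum_split_at d) /tail_gap => H.
have : 0 <= \sum_(j < n | (j < d)%N) modulus (z 0 j) ^+ 2.
  by apply: sumr_ge0 => j _; exact: sqr_ge0.
lra.
Qed.

Section cross_index_facts.
Variables (k : nat) (z : 'Cn[R]_n).
Hypotheses (k0 : (1 <= k <= n)%N) (zB : unit_ball z).
Hypothesis ord : forall i j : 'I_n, (i <= j)%N -> (j < k)%N ->
  modulus (z 0 i) <= modulus (z 0 j).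
Let d := cross_index k z.
Let P (i : 'I_n) := (i < k)%N && (i.+1%:R * modulus (z 0 i) ^+ 2
  + \sum_(j < n | (i < j)%N) modulus (z 0 j) ^+ 2 <= 1).

Lemma cross_index_attained : exists2 i : 'I_n, P i & d = i.+1.
Proof.
have n0 : (0 < n)%N by case/andP: k0; exact: leq_trans.
have P0 : P (Ordinal n0).
  rewrite /P /= mul1r; case/andP: k0 => -> _ /=.
  rewrite -(sum_from_split (fun j => modulus (z 0 j) ^+ 2) (Ordinal n0)) ltW //.
  exact/unit_ballE.
have : (0 < #|P|)%N by apply/card_gt0P; exists (Ordinal n0).
by case/(eq_bigmax_cond (fun i : 'I_n => i.+1)) => i Pi iE; exists i.
Qed.

Lemma cross_index_bounds : (0 < d <= k)%N.
Proof. by have [i /andP[ik _] ->] := cross_index_attained. Qed.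

(** The point of the definition of the index: the polydisc of radius [Num.sqrt
    (tail_gap d z / d)] in the first [d] coordinates lies in the ball and its
    closure contains [z]. *)
Lemma cross_index_below (j : 'I_n) : (j < d)%N ->
  d%:R * modulus (z 0 j) ^+ 2 <= tail_gap d z.
Proof.
have [i /andP[ik iP] dE] := cross_index_attained.
rewrite dE ltnS => ji; rewrite /tail_gap; have := ord ji ik => H.
have : modulus (z 0 j) ^+ 2 <= modulus (z 0 i) ^+ 2.
  by rewrite ler_pXn2r // ?nnegrE ?modulus_ge0.
move=> /(ler_wpM2l (ler0n R i.+1)); lra.
Qed.

(** By maximality of the index; it makes the exponents [weight] of the extremal
    function nonnegative. *)
Lemma cross_index_above (j : 'I_n) : (d <= j)%N -> (j < k)%N ->
  tail_gap d z < d%:R * modulus (z 0 j) ^+ 2.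
Proof.
move=> dj jk; have dn : (d < n)%N by apply: leq_ltn_trans dj _.
have dk : (d < k)%N by apply: leq_ltn_trans dj _.
have : ~~ P (Ordinal dn).
  apply/negP => Pd; have := @leq_bigmax_cond _ P (fun i : 'I_n => i.+1) _ Pd.
  by rewrite /= -/(cross_index k z) -/d ltnn.
rewrite /P /= dk /= -ltNge /tail_gap.
rewrite (sum_from_split (fun j => modulus (z 0 j) ^+ 2) (Ordinal dn)) /=.
have : modulus (z 0 (Ordinal dn)) ^+ 2 <= modulus (z 0 j) ^+ 2.
  by rewrite ler_pXn2r // ?nnegrE ?modulus_ge0 // ord.
move=> /(ler_wpM2l (ler0n R d)); rewrite -natr1; lra.
Qed.
End cross_index_facts.

Definition coord_line w (i : 'I_n) l : 'Cn[R]_n := w + l *: delta_mx 0 i.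

Lemma coord_lineE w i l j : coord_line w i l 0 j = w 0 j + (if j == i then l else 0).
Proof. by rewrite !mxE eqxx /= /GRing.scale /=; case: eqP => _;
  rewrite ?mulr1 ?mulr0. Qed.

(** The only property of a competitor used for the upper bound: it satisfies
    the Schwarz lemma on coordinate discs centred on the [k] hyperplanes. *)
Definition coord_schwarz (k : nat) (u : 'Cn[R]_n -> R) := forall w (i : 'I_n) (M rho : R),
  (i < k)%N -> w 0 i = 0 -> 0 < rho ->
  (forall l, modulus l < rho -> unit_ball (coord_line w i l)) ->
  (forall l, modulus l < rho -> u (coord_line w i l) <= M) ->
  forall l, modulus l < rho -> u (coord_line w i l) <= M * modulus l / rho.

(** On the part of the closed polydisc of radius [rho] that lies in the ball,
    the bound by the product of the first [m] factors does not involve the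
    coordinate [m]. So the Schwarz lemma in that coordinate, with this product
    as the bound [M], adds the next factor. *)
Lemma coord_schwarz_bound (k d : nat) (u : 'Cn[R]_n -> R) z (rho : R) :
    coord_schwarz k u -> (d <= k <= n)%N -> 0 < rho ->
    d%:R * rho ^+ 2 = tail_gap d z ->
    (forall w, unit_ball w -> u w <= 1) -> unit_ball z ->
    (forall j : 'I_n, (j < d)%N -> modulus (z 0 j) <= rho) ->
  u z <= \prod_(j < n | (j < d)%N) (modulus (z 0 j) / rho).
Proof.
move=> us /andP[dk kn] rho0 drho u1 zB zrho.
have dn := leq_trans dk kn.
pose P w := [/\ unit_ball w, forall j : 'I_n, (j < d)%N -> modulus (w 0 j) <= rho &
  forall j : 'I_n, (d <= j)%N -> w 0 j = z 0 j].
have sum_rho : \sum_(j < n | (j < d)%N) rho ^+ 2 = d%:R * rho ^+ 2.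
  rewrite -(big_ord_widen n (fun=> rho ^+ 2) dn) big_const_ord iter_addr_0.
  by rewrite mulr_natl.
suff H m : (m <= d)%N -> forall w, P w ->
    u w <= \prod_(j < n | (j < m)%N) (modulus (w 0 j) / rho) by apply: H.
elim: m => [|m IH] md w Pw.
  by rewrite big_pred0 //; apply: u1; case: Pw.
have mn : (m < n)%N by exact: leq_trans dn.
pose i := Ordinal mn.
have id : (i < d)%N by [].
have prodS (v : 'Cn[R]_n) : \prod_(j < n | (j < m.+1)%N) (modulus (v 0 j) / rho) =
    \prod_(j < n | (j < m)%N) (modulus (v 0 j) / rho) * (modulus (v 0 i) / rho) :> R.
  rewrite (bigD1 i) /= ?ltnSn // mulrC; congr (_ * _); apply: eq_bigl => j.
  by rewrite ltnS [in RHS]ltn_neqAle andbC -val_eqE.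
rewrite prodS; case: (Pw) => wB wr wz.
(* A coordinate on the boundary of the polydisc contributes the factor 1. *)
have := wr i id; rewrite le_eqVlt => /predU1P[->|wi].
  by rewrite divff ?gt_eqF // mulr1; apply: IH => //; exact: ltnW.
pose w0 := coord_line w i (- w 0 i).
have w0i : w0 0 i = 0 by rewrite coord_lineE eqxx subrr.
have lE l j : coord_line w0 i l 0 j = if j == i then l else w 0 j.
  by rewrite !coord_lineE; case: eqP => [->|_]; rewrite ?subrr ?add0r ?addr0.
have Pl l : modulus l < rho -> P (coord_line w0 i l).
  move=> lrho; have Pr (j : 'I_n) : (j < d)%N -> modulus (coord_line w0 i l 0 j) <= rho.
    by move=> jd; rewrite lE; case: ifP => _; [exact: ltW|exact: wr].
  have Pz (j : 'I_n) : (d <= j)%N -> coord_line w0 i l 0 j = z 0 j.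
    by move=> dj; rewrite lE ifF ?wz //; apply: contraTF dj => /eqP ->; rewrite -ltnNge.
  split => //; apply/unit_ballE; rewrite (sum_split_at d).
  have -> : \sum_(j < n | (d <= j)%N) modulus (coord_line w0 i l 0 j) ^+ 2 = 1
    - tail_gap d z.
    by rewrite /tail_gap opprB addrC subrK; apply: eq_bigr => j /Pz ->.
  suff : \sum_(j < n | (j < d)%N) modulus (coord_line w0 i l 0 j) ^+ 2 <
    tail_gap d z by lra.
  rewrite -drho -sum_rho (bigD1 i) //= [ltRHS](bigD1 i) //=.
  apply: ltr_leD.
    by rewrite lE eqxx ltr_pXn2r // ?nnegrE ?modulus_ge0 // ltW.
  apply: ler_sum => j /andP[jd _].
  by rewrite ler_pXn2r // ?nnegrE ?modulus_ge0 ?(ltW rho0) // Pr.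
have wE : w = coord_line w0 i (w 0 i).
  by apply/rowP => j; rewrite lE; case: eqP => // ->.
rewrite mulrA {1}wE; apply: (us w0 i) => //.
- exact: leq_trans id dk.
- by move=> l /Pl[].
- move=> l /Pl Pll; apply: le_trans (IH (ltnW md) _ Pll) _.
  rewrite le_eqVlt; apply/orP; left; apply/eqP; apply: eq_bigr => j jm.
  by rewrite lE ifF //; apply: contraTF jm => /eqP ->; rewrite /= ltnn.
Qed.

Lemma ball_crossP (k : nat) w (i : 'I_n) : unit_ball w -> (i < k)%N -> w 0 i = 0 ->
  ball_cross k w.
Proof. by move=> wB ik wi; split => //; rewrite (bigD1 i) //= wi mul0r. Qed.

Lemma coord_line0 w i : coord_line w i 0 = w.
Proof. by apply/rowP => j; rewrite coord_lineE; case: ifP; rewrite addr0. Qed.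

Lemma green_coord_schwarz (k : nat) (u : 'Cn[R]_n -> R) :
  green_competitor (@unit_ball R n) (@ball_cross R n k) u -> coord_schwarz k u.
Proof.
move=> [u01 [_ _ psh] uA] w i M rho ik wi rho0 lB lM l lrho.
have wB : unit_ball w by rewrite -(coord_line0 w i); apply: lB; rewrite modulus0.
have [C C0 uC] := uA w (ball_crossP wB ik wi).
apply: (@log_subharmonic_schwarz _ _ (fun l => u (coord_line w i l)) M C rho
  (psh w (delta_mx 0 i) wB)) => //.
move=> l' l'rho; have lB' := lB _ l'rho.
have /andP[-> _] := u01 _ lB'; apply: le_trans (uC _ lB') _; rewrite ler_pM2l //.
rewrite /enorm (bigD1 i) //= big1 => [|j ji].
  by rewrite !mxE !eqxx /= addr0 addrC addKr /GRing.scale /= mulr1 sqrtr_sqr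
    ger0_norm ?modulus_ge0.
by rewrite !mxE (negPf ji) andbF /GRing.scale /= mulr0 addr0 subrr modulus0 expr0n.
Qed.

Lemma mobius_coord_schwarz (k : nat) (f : 'Cn[R]_n -> R[i]^o) :
  mobius_competitor (@unit_ball R n) (@ball_cross R n k) f ->
  coord_schwarz k (fun w => modulus (f w)).
Proof.
move=> [f1 df fA] w i M rho ik wi rho0 lB lM l lrho.
have wB : unit_ball w by rewrite -(coord_line0 w i); apply: lB; rewrite modulus0.
apply: (@holomorphic_schwarz _ (fun l => f (coord_line w i l)) M rho) => //.
  by rewrite coord_line0; apply: fA; exact: ball_crossP ik wi.
move=> l' l'rho.
have dl : differentiable (coord_line w i : R[i]^o -> _) (l' : R[i]^o).
  apply: differentiableD; first exact: differentiable_cst.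
  by apply: differentiableZl.
have := differentiable_comp dl (df _ (lB _ l'rho)).
move=> /derivable1_diffP/derivableP dfl.
by eexists; exact: (cderiv_of_is_derive dfl).
Qed.
End upper_bound.

(** * Products of affine forms are log-plurisubharmonic *)

Section decreasing_limit.
Context {R : realType}.
Notation mu := (@lebesgue_measure R).

(** Monotone convergence for [h 0 - h m], whose integrals are at most that of
    [h 0] minus [c]; this makes [v] integrable. *)
Lemma decreasing_limit_integral (a b c : R) (h : nat -> R -> R) (v : R -> \bar R) :
    (forall m, cont_on (h m) a b) -> measurable_fun `[a, b] v ->
    (forall m m' t, (m <= m')%N -> h m' t <= h m t) ->
    (forall m t, (v t <= (h m t)%:E)%E) ->
    (forall t (e : R), (v t < e%:E)%E -> exists m, h m t < e) ->
    (forall m, c <= itv_int (h m) a b) ->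
  (c%:E <= \int[mu]_(t in `[a, b]) v t)%E.
Proof.
move=> ch mv hdec vh hlim hc.
have ih m : mu.-integrable `[a, b] (EFin \o h m) by exact: cont_on_integrable.
have Eh m : (\int[mu]_(t in `[a, b]) (h m t)%:E)%E = (itv_int (h m) a b)%:E.
  by rewrite /itv_int /Rintegral fineK //; apply: integrable_fin_num => //; exact: ih.
pose phi t := ((h 0 t)%:E - v t)%E.
pose g m t := ((h 0 t)%:E - (h m t)%:E)%E.
have mphi : measurable_fun `[a, b] phi.
  apply: emeasurable_funB => //; exact: measurable_int (ih 0).
have mg m : measurable_fun `[a, b] (g m).
  by apply: emeasurable_funB; [exact: measurable_int (ih 0)|exact: measurable_int (ih m)].
have g0 m t : `[a, b]%classic t -> (0 <= g m t)%E.
  by move=> _; rewrite /g -EFinB lee_fin subr_ge0; exact: hdec.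
have phi0 t : `[a, b]%classic t -> (0 <= phi t)%E.
  by move=> _; rewrite /phi sube_ge0 ?vh // orbT.
have ndg t : `[a, b]%classic t -> {homo g^~ t : m m' / (m <= m')%N >-> (m <= m')%E}.
  by move=> _ m m' mm'; rewrite /g -!EFinB lee_fin lerB //; exact: hdec.
have int_g m : (\int[mu]_(t in `[a, b]) g m t <= (itv_int (h 0) a b - c)%:E)%E.
  rewrite (integralB _ (ih 0) (ih m)) //=.
  by rewrite !Eh -EFinB lee_fin lerB.
have cvg_g := cvg_monotone_convergence (mu := mu) (measurable_itv `[a, b]%R) mg g0 ndg.
have int_lim : (\int[mu]_(t in `[a, b]) limn (g^~ t) <= (itv_int (h 0) a b - c)%:E)%E.
  rewrite -(cvg_lim _ cvg_g) //; apply: lime_le; first by apply/cvg_ex;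
    eexists; exact: cvg_g.
  by apply: nearW => p; apply: int_g.
have phi_lim t : `[a, b]%classic t -> (phi t <= limn (g^~ t))%E.
  move=> abt; have cg := ereal_nondecreasing_cvgn (ndg t abt).
  rewrite (cvg_lim _ cg) // leNgt; apply/negP => /lt_le_real[e [se ephi]].
  have [e1 [se1 e1e]] := lte_between se.
  have [|m hm] := hlim t (h 0 t - e1).
    move: ephi (vh 0 t); rewrite /phi; case: (v t) => [x| |] //; last by rewrite ltNyr.
    by rewrite -EFinB !lee_fin lte_fin; lra.
  have : (e1%:E < g m t)%E by rewrite /g -EFinB lte_fin; lra.
  rewrite ltNge => /negP; apply; apply: ltW; apply: le_lt_trans se1.
  by apply: ereal_sup_ubound; exists m.
have int_phi : (\int[mu]_(t in `[a, b]) phi t <= (itv_int (h 0) a b - c)%:E)%E.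
  apply: le_trans int_lim; apply: ge0_le_integral => //.
  by apply: (emeasurable_fun_cvg g) => // t abt;
    exact: ereal_nondecreasing_is_cvgn (ndg t abt).
have iphi : mu.-integrable `[a, b] phi.
  apply/integrableP; split => //; apply: le_lt_trans (ltry (itv_int (h 0) a b - c)).
  apply: le_trans int_phi; rewrite le_eqVlt; apply/orP; left; apply/eqP.
  by apply: eq_integral => t /set_mem abt; rewrite gee0_abs //; exact: phi0.
have vE : (fun t => v t) = (fun t => (h 0 t)%:E - phi t)%E.
  apply/funext => t; rewrite /phi; case: (v t) (vh 0 t) => [x| |] //= _.
  by rewrite -EFinB; congr EFin; ring.
rewrite vE (integralB _ (ih 0) iphi) //= Eh.
have fphi : (\int[mu]_(t in `[a, b]) phi t)%E \is a fin_num.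
  by apply: integrable_fin_num.
rewrite leeBrDr // addeC -leeBrDr //.
Qed.
End decreasing_limit.

Section log_affine.
Context {R : realType}.

Lemma modulus_prod (I : Type) (r : seq I) (P : pred I) (F : I -> R[i]) :
  modulus (\prod_(i <- r | P i) F i) = \prod_(i <- r | P i) modulus (F i).
Proof.
by apply: (big_morph (@modulus R) (@modulusM R) (@modulus1 R)).
Qed.

Lemma lne_modulus_usc (T : topologicalType) (U : set T) (f : T -> R[i]^o) :
  (forall x, U x -> {for x, continuous f}) ->
  usc_on U (fun x => lne (modulus (f x))%:E).
Proof.
move=> cf x Ux c; rewrite lne_real => fc.
have fxc : modulus (f x) < expR c.
  move: fc; case: ifPn => [f0|]; last by rewrite -leNgt => /le_lt_trans f0 _;
    apply: f0; exact: expR_gt0.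
  by rewrite lte_fin => lnc; rewrite -[ltLHS]lnK ?posrE // ltr_expR.
have nb : \forall y \near (f x : R[i]^o), modulus y < expR c.
  apply/nbhs_modulus; exists (expR c - modulus (f x)); first by rewrite subr_gt0.
  by move=> y; have := modulusD (y - f x) (f x); rewrite subrK; lra.
have nx : \forall y \near x, modulus (f y) < expR c by exact: cf x Ux _ nb.
apply: filterS nx => y fyc _; rewrite lne_real; case: ifPn => fy; last by rewrite ltNyr.
by rewrite lte_fin -ltr_expR lnK ?posrE.
Qed.

Lemma modulus_affine_circle (a b : R[i]) : a != 0 -> exists th, forall (r t : R),
  let rho := r * modulus b / modulus a in
  modulus (a + (r * cos t +i* (r * sin t))%C * b) ^+ 2 =
  modulus a ^+ 2 * (1 + rho ^+ 2 - 2 * rho * cos (1%:R * t + th)).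
Proof.
move=> a0; have ma0 : modulus a != 0 by rewrite modulus_eq0.
have [->|b0] := eqVneq b 0.
  by exists 0 => r t rho;
    rewrite /rho modulus0 !mulr0 !mul0r !addr0 expr0n /= addr0 mulr0 mul0r subr0 mulr1.
have mb0 : modulus b != 0 by rewrite modulus_eq0.
have [th thE] := modulus_circle_angle (a / b); exists th => r t rho; rewrite /rho.
have -> : a + (r * cos t +i* (r * sin t))%C * b = b * circle_point (a / b) r t.
  by rewrite /circle_point mulrDr (mulrC b (a / b)) divfK // (mulrC b).
by rewrite modulusM exprMn thE modulusM modulusV; field; rewrite ma0 mb0.
Qed.

(** By continuity of the product at the shift 0. *)
Lemma prod_perturb (I : Type) (r : seq I) (F : I -> R) (e : R) :
    \prod_(i <- r) F i < e ->
  exists m : nat, \prod_(i <- r) (F i + m.+1%:R^-1) < e.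
Proof.
move=> Fe; pose G x := \prod_(i <- r) (F i + x).
have cG : continuous G.
  rewrite /G; elim: r {Fe G} => [|i r IH] x.
    by under eq_fun do rewrite big_nil; exact: cvg_cst.
  under eq_fun do rewrite big_cons; apply: cvgM; last exact: IH.
  by apply: cvgD; [exact: cvg_cst|exact: cvg_id].
have /cvgrPdist_lt/(_ (e - G 0)) := cG 0.
have G0 : G 0 = \prod_(i <- r) F i by apply: eq_bigr => i _; rewrite addr0.
rewrite subr_gt0 {1}G0 => /(_ Fe)/nbhs_normP[d /= d0 H].
exists (Num.truncn d^-1); apply: (@lt_le_trans _ _ (G 0 + (e - G 0)));
  last by rewrite subrKC.
set x := _^-1; rewrite -ltrBlDl; apply: le_lt_trans (ler_norm _) _.
rewrite distrC; apply: H; rewrite /ball_ /= sub0r normrN gtr0_norm ?invr_gt0 //.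
by rewrite invf_plt ?posrE // truncnS_gt.
Qed.

Lemma continuous_prod_affine (s : seq (R[i] * R[i])) :
  continuous (fun z : R[i]^o => \prod_(p <- s) (p.1 + z * p.2) : R[i]^o).
Proof.
move=> z; apply: differentiable_continuous; elim: s => [|p s IH].
  have -> : (fun z : R[i]^o => \prod_(p <- [::]) (p.1 + z * p.2) : R[i]^o) = cst 1.
    by apply/funext => y; rewrite big_nil.
  exact: differentiable_cst.
have -> : (fun z : R[i]^o => \prod_(p <- p :: s) (p.1 + z * p.2) : R[i]^o) =
    (cst (p.1 : R[i]^o) + (id : R[i]^o -> R[i]^o) * cst (p.2 : R[i]^o)) *
    (fun z : R[i]^o => \prod_(p <- s) (p.1 + z * p.2) : R[i]^o).
  by apply/funext => y; rewrite big_cons.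
apply: differentiableM; last exact: IH.
apply: differentiableD; first exact: differentiable_cst.
by apply: differentiableM => //; exact: differentiable_cst.
Qed.

(** On the circle, the squared modulus of each factor is a constant times [1 +
    rho ^+ 2 - 2 * rho * cos (t + th)], which vanishes somewhere if [rho = 1].
    Adding [m.+1%:R^-1] to it keeps the integrand continuous, and by
    [log_cos_int_ge0] the mean at least the value at the centre; then [m] tends
    to infinity. *)
Lemma log_affine_submean (s : seq (R[i] * R[i])) (a : R[i]) (r : R) : 0 < r ->
  (lne (modulus (\prod_(p <- s) (p.1 + a * p.2)))%:E <=
   ((2 * pi)^-1)%:E * \int[lebesgue_measure]_(t in `[0%R, (2 * pi)%R])
     lne (modulus (\prod_(p <- s) (p.1 + circle_point a r t * p.2)))%:E)%E.
Proof.
move=> r0; have pi0 : 0 < 2 * pi :> R by rewrite mulr_gt0 // pi_gt0.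
pose A (p : R[i] * R[i]) := p.1 + a * p.2.
(* If a factor vanishes at the centre then the left-hand side is [-oo]. *)
have [nz|] := boolP (all (fun p => A p != 0) s); last first.
  rewrite -has_predC => /hasP[p ps /negPn/eqP Ap].
  have -> : \prod_(p <- s) (p.1 + a * p.2) = 0.
    by apply/eqP; rewrite prodf_seq_eq0; apply/hasP; exists p; rewrite //= -/(A p) Ap.
  by rewrite modulus0 lne_real ltxx leNye.
pose rho p := r * modulus p.2 / modulus (A p).
have rho0 p : 0 <= rho p by rewrite /rho divr_ge0 ?modulus_ge0 // mulr_ge0
  ?modulus_ge0 // ltW.
have ex p : exists th, A p != 0 -> forall t,
    modulus (A p + (r * cos t +i* (r * sin t))%C * p.2) ^+ 2 =
    modulus (A p) ^+ 2 * (1 + rho p ^+ 2 - 2 * rho p * cos (1%:R * t + th)).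
  have [->|Ap] := eqVneq (A p) 0; first by exists 0.
  by have [th thE] := modulus_affine_circle p.2 Ap; exists th => _ t; exact: thE.
have [th thE] := boolp.choice ex.
pose kap := modulus (\prod_(p <- s) A p).
have kap0 : 0 < kap.
  rewrite modulus_gt0 prodf_seq_neq0; apply/allP => p ps /=.
  by move/allP: nz => /(_ p ps).
pose x p t := 1 + rho p ^+ 2 - 2 * rho p * cos (1%:R * t + th p).
have x0 p t : 0 <= x p t.
  have c1 : 0 <= 1 - cos (1%:R * t + th p) by rewrite subr_ge0 cos_le1.
  by have := mulr_ge0 (rho0 p) c1; have := sqr_ge0 (1 - rho p); rewrite /x; lra.
have prodE t : modulus (\prod_(p <- s) (p.1 + circle_point a r t * p.2)) ^+ 2 =
    kap ^+ 2 * \prod_(p <- s) x p t.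
  rewrite /kap !modulus_prod !expr2 -!big_split /= big_seq [RHS]big_seq.
  apply: eq_bigr => p ps; rewrite -!expr2 /x -thE; last by move/allP: nz => /(_ p ps).
  by congr (modulus _ ^+ 2); rewrite /A /circle_point mulrDl addrA.
pose del m : R := m.+1%:R^-1.
have del0 m : 0 < del m by rewrite invr_gt0.
have al m p : 2 * rho p < 1 + rho p ^+ 2 + del m.
  have := del0 m; have := sqr_ge0 (1 - rho p); nra.
have be p : 0 <= 2 * rho p by rewrite mulr_ge0.
pose h m t := ln kap + 2^-1 * \sum_(p <- s) log_cos (1 + rho p ^+ 2 + del m) (2
  * rho p) 1 (th p) t.
have csum m (s' : seq (R[i] * R[i])) : continuous (fun t =>
    \sum_(p <- s') log_cos (1 + rho p ^+ 2 + del m) (2 * rho p) 1 (th p) t : R).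
  elim: s' => [|p s' IH] t.
    by under eq_fun do rewrite big_nil; exact: cvg_cst.
  under eq_fun do rewrite big_cons; apply: cvgD; last exact: IH.
  exact: continuous_log_cos (be p) (al m p) _.
have isum m (s' : seq (R[i] * R[i])) : 0 <= itv_int (fun t =>
    \sum_(p <- s') log_cos (1 + rho p ^+ 2 + del m) (2 * rho p) 1 (th p) t) 0 (2 * pi).
  elim: s' => [|p s' IH].
    rewrite (eq_itv_int (g := fun=> 0)) => [|t _]; last by rewrite big_nil.
    by rewrite itv_int_cst ?mul0r // ltW.
  rewrite (eq_itv_int (g := fun t => log_cos (1 + rho p ^+ 2 + del m) (2 * rho
    p) 1 (th p) t +
    \sum_(p <- s') log_cos (1 + rho p ^+ 2 + del m) (2 * rho p) 1 (th p) t)).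
    rewrite itv_intD; last 2 first.
    - by move=> t _; exact: continuous_log_cos (be p) (al m p) _.
    - by move=> t _; exact: csum.
    rewrite addr_ge0 // log_cos_int_ge0 //.
    by have := del0 m; lra.
  by move=> t _; rewrite big_cons.
pose Pm m t := \prod_(p <- s) (x p t + del m).
have Pm0 m t : 0 < Pm m t by apply: prodr_gt0 => p _; rewrite ltr_wpDl.
have hE m t : h m t = ln kap + 2^-1 * ln (Pm m t).
  congr (_ + _ * _); rewrite /Pm.
  elim: (s) => [|p s' IH]; first by rewrite !big_nil ln1.
  rewrite !big_cons lnM ?posrE; last 2 first.
  - by rewrite ltr_wpDl.
  - by apply: prodr_gt0 => q _; rewrite ltr_wpDl.
  by rewrite IH /log_cos /x; congr (ln _ + _); ring.
pose v t := lne (modulus (\prod_(p <- s) (p.1 + circle_point a r t * p.2)))%:E.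
have vE t : v t = if 0 < \prod_(p <- s) x p t
    then (ln kap + 2^-1 * ln (\prod_(p <- s) x p t))%:E else -oo%E.
  rewrite /v lne_real.
  have q0 := modulus_ge0 (\prod_(p <- s) (p.1 + circle_point a r t * p.2)).
  have -> : (0 < \prod_(p <- s) x p t) =
      (0 < modulus (\prod_(p <- s) (p.1 + circle_point a r t * p.2))).
    rewrite -(pmulr_rgt0 _ (exprn_gt0 2 kap0)) -prodE.
    by rewrite exprn_even_gt0 //= lt_def q0 andbT.
  case: ifPn => // q1; congr EFin.
  have : ln (modulus (\prod_(p <- s) (p.1 + circle_point a r t * p.2)) ^+ 2) =
    ln (kap ^+ 2 * \prod_(p <- s) x p t) by rewrite prodE.
  have P0 : 0 < \prod_(p <- s) x p t.
    by rewrite -(pmulr_rgt0 _ (exprn_gt0 2 kap0)) -prodE exprn_gt0.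
  rewrite lnM ?posrE ?exprn_gt0 // !lnXn //.
  rewrite -[ln kap *+ 2]mulr_natl -[ln (modulus _) *+ 2]mulr_natl => H; lra.
rewrite -/A -/kap lne_real kap0.
rewrite -lee_pdivrMl ?invr_gt0 // invrK -EFinM.
apply: (decreasing_limit_integral (h := h)).
- move=> m t _; apply: cvgD; first exact: cvg_cst.
  by apply: cvgM; [exact: cvg_cst|exact: csum].
- apply: measurable_funTS; apply: (@usc_circle_measurable _ setT
     (fun z => lne (modulus (\prod_(p <- s) (p.1 + z * p.2)))%:E)) => //.
  apply: lne_modulus_usc => z _; exact: continuous_prod_affine.
- move=> m m' t mm'; rewrite !hE lerD2l ler_pM2l ?invr_gt0 // ler_ln ?posrE //.
  apply: ler_prod => p _; rewrite addr_ge0 ?(ltW (del0 _)) //= lerD2l.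
  by rewrite /del lef_pV2 ?posrE ?ltr0n // ler_nat.
- move=> m t; rewrite -/(v t) vE; case: ifPn => P0; last by rewrite leNye.
  rewrite hE lee_fin lerD2l ler_pM2l ?invr_gt0 // ler_ln ?posrE //.
  by apply: ler_prod => p _; rewrite x0 /= lerDl ltW.
- move=> t e; rewrite -/(v t) vE => vte.
  have [|m Hm] := @prod_perturb _ s (fun p => x p t) (expR (2 * (e - ln kap))).
    move: vte; case: ifPn => P0; last by move=> _;
      apply: le_lt_trans (expR_gt0 _); rewrite leNgt.
    rewrite lte_fin => vte; rewrite -[ltLHS]lnK ?posrE // ltr_expR; lra.
  exists m; rewrite hE.
  have : ln (Pm m t) < 2 * (e - ln kap) by rewrite -ltr_expR lnK ?posrE.
  lra.
- move=> m; rewrite /h itv_intD; last 2 first.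
  - by move=> t _; exact: cvg_cst.
  - by move=> t _; apply: cvgM; [exact: cvg_cst|exact: csum].
  rewrite itv_int_cst ?(ltW pi0) // subr0 itv_intZ; last by move=> t _; exact: csum.
  by rewrite mulrC lerDl mulr_ge0.
Qed.
End log_affine.

Section affine_products.
Context {R : realType} (n : nat).
Implicit Types (w z X : 'Cn[R]_n) (l : R[i]) (p : R[i] * 'Cn[R]_n) (s : seq
  (R[i] * 'Cn[R]_n)).

Definition lin_form (v w : 'Cn[R]_n) : R[i] := \sum_(j < n) v 0 j * w 0 j.
Definition affine_form p w : R[i] := p.1 + lin_form p.2 w.
(** Products of affine forms are holomorphic, and on every complex line they
    are again products of affine forms, now in one variable. *)
Definition affine_prod s w : R[i]^o := \prod_(p <- s) affine_form p w.

Lemma affine_form_line p w X l :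
  affine_form p (w + l *: X) = affine_form p w + l * lin_form p.2 X.
Proof.
rewrite /affine_form -addrA; congr (_ + _).
rewrite /lin_form mulr_sumr -big_split /=; apply: eq_bigr => j _.
by rewrite !mxE /GRing.scale /=; ring.
Qed.

Lemma affine_prod_differentiable s w : differentiable (affine_prod s) w.
Proof.
elim: s => [|p s IH].
  have -> : affine_prod [::] = cst 1 by apply/funext => y; rewrite /affine_prod big_nil.
  exact: differentiable_cst.
have -> : affine_prod (p :: s) = (fun y => affine_form p y : R[i]^o) * affine_prod s.
  by apply/funext => y; rewrite /affine_prod big_cons.
apply: differentiableM; last exact: IH.
have -> : (fun y => affine_form p y : R[i]^o) =
    cst (p.1 : R[i]^o) + \sum_(j < n) (cst (p.2 0 j : R[i]^o) * (fun y :
      'Cn[R]_n => y 0 j : R[i]^o)).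
  by apply/funext => y; rewrite /affine_form /lin_form fctE fct_sumE.
apply: differentiableD; first exact: differentiable_cst.
apply: differentiable_sum => j; apply: differentiableM; first exact: differentiable_cst.
exact: differentiable_coord.
Qed.

End affine_products.

Section affine_psh.
Context {R : realType} (n : nat).
Implicit Types (w z X : 'Cn[R]_n).

Lemma affine_prod_psh (s : seq (R[i] * 'Cn[R]_n)) (G : set 'Cn[R]_n) :
  plurisubharmonic_on G (fun w => lne (modulus (affine_prod s w))%:E).
Proof.
have lty x : (lne x%:E < +oo :> \bar R)%E by rewrite lne_real; case: ifP; rewrite ?ltry.
split => //.
  apply: lne_modulus_usc => w _; apply: differentiable_continuous.
  exact: affine_prod_differentiable.
move=> z X _; pose s' := [seq (affine_form p z, lin_form p.2 X) | p <- s].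
have sE l : affine_prod s (z + l *: X) = \prod_(q <- s') (q.1 + l * q.2).
  by rewrite /affine_prod big_map; apply: eq_bigr => p _; exact: affine_form_line.
have -> : (fun l : R[i]^o => lne (modulus (affine_prod s (z + l *: X)))%:E) =
    (fun l : R[i]^o => lne (modulus (\prod_(q <- s') (q.1 + l * q.2)))%:E).
  by apply/funext => l; rewrite sE.
split => //.
  by apply: lne_modulus_usc => l _; exact: continuous_prod_affine.
by move=> a r r0 _; exact: log_affine_submean.
Qed.
End affine_psh.

(** * The extremal functions *)

Section real_bounds.
Context {R : realType}.
Implicit Types x y t : R.

Lemma le_expR_sqr x : x <= expR ((x ^+ 2 - 1) / 2).
Proof.
apply: le_trans (expR_ge1Dx _); have := sqr_ge0 (x - 1); lra.
Qed.

Lemma le_expR_sub1 x : x <= expR (x - 1).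
Proof. by apply: le_trans (expR_ge1Dx _); lra. Qed.

Lemma compound_le_expR x M : 0 <= x -> (1 + x / M.+1%:R) ^+ M.+1 <= expR x.
Proof.
move=> x0; have -> : expR x = expR (x / M.+1%:R) ^+ M.+1.
  by rewrite -expRM_natr divfK // pnatr_eq0.
have y0 : 0 <= x / M.+1%:R by rewrite divr_ge0.
by rewrite ler_pXn2r ?nnegrE ?expR_ge0 ?expR_ge1Dx ?addr_ge0.
Qed.

(** From [expR (y / (1 + y)) <= 1 + y] with [y = x / M.+1]. *)
Lemma compound_ge_expR x M : 0 <= x ->
  expR x * (1 - x ^+ 2 / M.+1%:R) <= (1 + x / M.+1%:R) ^+ M.+1.
Proof.
move=> x0; have M0 : 0 < M.+1%:R :> R by rewrite ltr0n.
set y := x / M.+1%:R; have y0 : 0 <= y by rewrite divr_ge0.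
have y1 : 0 < 1 + y by rewrite ltr_wpDr.
have h1 : expR (y / (1 + y)) <= 1 + y.
  rewrite -[leRHS]invrK -[expR _]invrK lef_pV2 ?posrE ?invr_gt0 ?expR_gt0 //.
  rewrite -expRN; apply: le_trans (expR_ge1Dx _).
  by rewrite le_eqVlt; apply/orP; left; apply/eqP; field; rewrite gt_eqF.
have h2 : expR (x - x ^+ 2 / M.+1%:R) <= (1 + y) ^+ M.+1.
  apply: (@le_trans _ _ (expR (y / (1 + y)) ^+ M.+1)).
    rewrite -expRM_natr ler_expR.
    have yM : y * M.+1%:R = x by rewrite divfK // gt_eqF.
    have -> : y / (1 + y) * M.+1%:R = x / (1 + y) by rewrite mulrAC yM.
    rewrite ler_pdivlMr //.
    have -> : x - x ^+ 2 / M.+1%:R = x * (1 - y) by rewrite mulrBr mulr1 expr2 -mulrA.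
    have := mulr_ge0 x0 (sqr_ge0 y); lra.
  by rewrite ler_pXn2r ?nnegrE ?expR_ge0 // ltW.
apply: le_trans h2; rewrite expRD ler_pM2l ?expR_gt0 //.
exact: expR_ge1Dx.
Qed.

Lemma modulus_sum_le (I : finType) (F : I -> R[i]) :
  modulus (\sum_i F i) <= \sum_i modulus (F i).
Proof.
apply: (big_ind2 (fun (u : R[i]) v => modulus u <= v)) => //; first by rewrite modulus0.
by move=> u1 v1 u2 v2 h1 h2; apply: le_trans (modulusD _ _) (lerD h1 h2).
Qed.
End real_bounds.

Section competitor.
Context {R : realType} (n k d : nat) (z : 'Cn[R]_n) (b : R).
Hypotheses (dk : (0 < d <= k)%N) (kn : (k <= n)%N) (b0 : 0 < b).
Hypothesis bE : b = tail_gap d z.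
Hypothesis above : forall j : 'I_n, (d <= j)%N -> (j < k)%N -> b < d%:R *
  modulus (z 0 j) ^+ 2.

Let a (j : 'I_n) := modulus (z 0 j).
Let c0 := d%:R / b.

Lemma ratio_gt0 : 0 < c0.
Proof. by rewrite divr_gt0 // ltr0n; case/andP: dk. Qed.

Lemma abs_coord_ge0 j : 0 <= a j. Proof. exact: modulus_ge0. Qed.

Lemma abs_coord_gt0 (j : 'I_n) : (d <= j)%N -> (j < k)%N -> 0 < a j.
Proof.
move=> dj jk; rewrite lt_def abs_coord_ge0 andbT; apply/eqP => aj.
by have := above dj jk; rewrite -/(a j) aj expr0n mulr0 ltNge (ltW b0).
Qed.

(** With [a j] the modulus of [z 0 j], for [j >= d] the derivative in [t j] at
    [t = a] of [- (d / 2) * ln (1 - \sum_(j >= d) t j ^+ 2)], minus that of [ln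
    (t j)] if [j < k], is [weight j * a j]. *)
Definition weight (j : 'I_n) : R :=
  if (d <= j)%N then c0 - (if (j < k)%N then (a j) ^- 2 else 0) else 0.

Lemma weight_ge0 j : 0 <= weight j.
Proof.
rewrite /weight; case: ifP => // dj; case: ifP => jk;
  last by rewrite subr0 ltW ?ratio_gt0.
have aj := abs_coord_gt0 dj jk;
  rewrite subr_ge0 /c0 ler_pdivlMr // mulrC ler_pdivrMr ?exprn_gt0 //.
exact: ltW (above dj jk).
Qed.

Definition normalizer (j : 'I_n) : R :=
  if (j < d)%N then Num.sqrt c0 else if (j < k)%N then (a j)^-1 else 1.

Lemma normalizer_ge0 j : 0 <= normalizer j.
Proof.
rewrite /normalizer; case: ifP => _; first exact: sqrtr_ge0.
by case: ifP => // _; rewrite invr_ge0 abs_coord_ge0.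
Qed.

Definition growth : R := \sum_j weight j * a j ^+ 2.

Lemma growth_ge0 : 0 <= growth.
Proof. by apply: sumr_ge0 => j _;
  rewrite mulr_ge0 ?weight_ge0 // exprn_ge0 // abs_coord_ge0. Qed.

Definition leading : R := (\prod_j normalizer j) * expR (- growth).

Lemma leading_ge0 : 0 <= leading.
Proof. by rewrite mulr_ge0 ?expR_ge0 // prodr_ge0 // => j _; exact: normalizer_ge0. Qed.

(** The bound in terms of the moduli [t j] of the coordinates for the limit
    [leading * \prod_(j < k) w_j * exp (\sum_j weight j * conj z_j * w_j)] of
    the extremal functions. *)
Definition envelope (t : 'I_n -> R) : R :=
  leading * \prod_(j < n | (j < k)%N) t j * expR (\sum_j weight j * (a j * t j)).

Lemma envelope_prod t : envelope t =
  \prod_j (normalizer j * (if (j < k)%N then t j else 1) *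
           expR (weight j * (a j * t j - a j ^+ 2))).
Proof.
rewrite /envelope /leading !big_split /= (big_mkcond (fun j : 'I_n => (j < k)%N)) /=.
rewrite -expR_sum; have -> : \sum_j weight j * (a j * t j - a j ^+ 2) =
    - growth + \sum_j weight j * (a j * t j).
  rewrite addrC /growth -sumrB; apply: eq_bigr => j _; ring.
rewrite expRD; ring.
Qed.

Lemma envelope_at : envelope a = \prod_(j < n | (j < d)%N) (a j * Num.sqrt c0).
Proof.
rewrite envelope_prod [RHS]big_mkcond /=; apply: eq_bigr => j _.
rewrite -expr2 subrr mulr0 expR0 mulr1 /normalizer; case: (ltnP j d) => jd.
  by case/andP: dk => _ /(leq_trans jd) ->; rewrite mulrC.
case: ifP => jk; last by rewrite mulr1.
by rewrite mulVf // gt_eqF // abs_coord_gt0.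
Qed.

(** Each factor of [envelope_prod] is at most the exponential of a quadratic
    expression in [t j], by [1 + y <= expR y] and [2 * a * t <= a ^+ 2 + t ^+
    2]; equality holds for [j >= d] at [t j = a j]. The quadratic expressions
    add up to the exponent on the right. *)
Lemma envelope_le t : (forall j, 0 <= t j) ->
  envelope t <= expR (c0 / 2 * (\sum_j t j ^+ 2 - 1)).
Proof.
move=> t0.
(* The constants are chosen so that the [e j] are the exponents bounding the
   factors. *)
pose e j := c0 / 2 * t j ^+ 2 - (if (j < d)%N then 2^-1 else c0 / 2 * a j ^+ 2).
have sum_e : \sum_j e j = c0 / 2 * (\sum_j t j ^+ 2 - 1).
  rewrite sumrB -mulr_sumr mulrBr mulr1; congr (_ - _).
  have dn : (d <= n)%N by apply: leq_trans kn; case/andP: dk.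
  rewrite (sum_split_at d).
  have -> : \sum_(j < n | (j < d)%N) (if (j < d)%N then 2^-1 else c0 / 2 * a j ^+ 2)
      = d%:R / 2 :> R.
    rewrite (eq_bigr (fun=> 2^-1)) => [|j ->] //.
    by rewrite -(big_ord_widen n (fun=> 2^-1) dn) big_const_ord iter_addr_0 mulr_natl.
  have -> : \sum_(j < n | (d <= j)%N) (if (j < d)%N then 2^-1 else c0 / 2 * a j ^+ 2)
      = c0 / 2 * (1 - b).
    rewrite bE /tail_gap opprB addrC subrK mulr_sumr; apply: eq_bigr => j.
    by rewrite leqNgt => /negPf ->.
  by rewrite /c0; field; rewrite gt_eqF.
rewrite envelope_prod -sum_e expR_sum; apply: ler_prod => j _; apply/andP; split.
  rewrite mulr_ge0 ?expR_ge0 // mulr_ge0 ?normalizer_ge0 //; by case: ifP.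
have tj := t0 j; have aj := abs_coord_ge0 j; have c00 := ratio_gt0.
(* Tangent line of [t ^+ 2 / 2] at [a j]. *)
have amgm : a j * t j - a j ^+ 2 <= 2^-1 * t j ^+ 2 - 2^-1 * a j ^+ 2.
  have := sqr_ge0 (t j - a j); lra.
rewrite /e /normalizer /weight; case: (ltnP j d) => jd.
  rewrite mul0r expR0 mulr1; case/andP: dk => _ /(leq_trans jd) ->.
  apply: le_trans (le_expR_sqr _) _; rewrite exprMn sqr_sqrtr ?(ltW c00) // ler_expR.
  by rewrite le_eqVlt; apply/orP; left; apply/eqP; field.
case: ifP => jk; last first.
  by rewrite subr0 !mul1r ler_expR; have := ler_wpM2l (ltW c00) amgm; lra.
have ajp := abs_coord_gt0 jd jk.
apply: le_trans (ler_wpM2r (expR_ge0 _) (le_expR_sub1 _)) _.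
rewrite -expRD ler_expR; have := ler_wpM2l (ltW c00) amgm.
have -> : (a j)^-1 * t j - 1 + (c0 - a j ^- 2) * (a j * t j - a j ^+ 2) =
  c0 * (a j * t j - a j ^+ 2) by field; rewrite gt_eqF.
lra.
Qed.

Definition direction : 'Cn[R]_n := \row_j ((weight j)%:C%C * (z 0 j)^*%C).

(** The exponential of the linear form is replaced by the compound power [(1 +
    L / N.+1) ^+ N.+1], so that the function is a product of affine forms. *)
Definition extremal_factors (N : nat) : seq (R[i] * 'Cn[R]_n) :=
  (leading%:C%C, 0) ::
  [seq (0, delta_mx 0 j) | j : 'I_n <- enum 'I_n & (j < k)%N] ++
  nseq N.+1 (1, (N.+1%:R^-1 : R[i]) *: direction).

Definition extremal N := affine_prod (extremal_factors N).

Lemma extremalE N w : extremal N w = leading%:C%C *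
  \prod_(j < n | (j < k)%N) w 0 j * (1 + lin_form direction w / N.+1%:R) ^+ N.+1.
Proof.
have lin0 : lin_form 0 w = 0.
  by rewrite /lin_form big1 // => j _; rewrite mxE mul0r.
have lind j : lin_form (delta_mx 0 j) w = w 0 j.
  rewrite /lin_form (bigD1 j) //= big1 => [|i ij].
    by rewrite mxE !eqxx mul1r addr0.
  by rewrite mxE (negPf ij) andbF mul0r.
have linZ c v : lin_form (c *: v) w = lin_form v w * c.
  rewrite /lin_form mulr_suml; apply: eq_bigr => j _.
  by rewrite mxE /GRing.scale /=; ring.
rewrite /extremal /affine_prod big_cons big_cat big_nseq iter_mulr_1 /=.
rewrite big_map big_filter big_enum_cond /affine_form /= lin0 addr0 -mulrA;
  congr (_ * (_ * _)).
  by apply: eq_bigr => j _; rewrite lind add0r.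
by rewrite linZ.
Qed.

Lemma modulus_conj (w : R[i]) : modulus w^*%C = modulus w.
Proof. by case: w => x y; rewrite /modulus /= sqrrN. Qed.

Lemma conj_mul (w : R[i]) : w^*%C * w = (modulus w ^+ 2)%:C%C.
Proof.
rewrite modulus_sqr; case: w => x y; apply/eqP; rewrite eq_complex /=.
by apply/andP; split; apply/eqP; ring.
Qed.

Lemma modulus_lin_direction w :
  modulus (lin_form direction w) <= \sum_j weight j * (a j * modulus (w 0 j)).
Proof.
apply: le_trans (modulus_sum_le _) _; apply: ler_sum => j _.
by rewrite mxE !modulusM modulus_real ger0_norm ?weight_ge0 // modulus_conj mulrA.
Qed.

Lemma lin_direction_at : lin_form direction z = growth%:C%C.
Proof.
rewrite /growth rmorph_sum; apply: eq_bigr => j _.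
by rewrite mxE -mulrA conj_mul -rmorphM.
Qed.

Lemma modulus_natr N : modulus (N%:R : R[i]) = N%:R.
Proof. by rewrite -[N%:R](rmorph_nat (real_complex R)) modulus_real ger0_norm. Qed.

Lemma extremal_le N w : modulus (extremal N w) <= envelope (fun j => modulus (w 0 j)).
Proof.
rewrite extremalE !modulusM modulus_real ger0_norm ?leading_ge0 // modulus_prod.
rewrite /envelope; apply: ler_wpM2l.
  by rewrite mulr_ge0 ?leading_ge0 // prodr_ge0 // => j _; exact: modulus_ge0.
rewrite modulusX; set Y := \sum_j _.
have Y0 : 0 <= Y.
  by apply: sumr_ge0 => j _; rewrite mulr_ge0 ?weight_ge0 // mulr_ge0 ?modulus_ge0.
apply: le_trans (compound_le_expR N Y0).
have YN : 0 <= Y / N.+1%:R by rewrite divr_ge0.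
rewrite ler_pXn2r ?nnegrE ?modulus_ge0 ?addr_ge0 //.
apply: le_trans (modulusD _ _) _; rewrite modulus1 lerD2l modulusM modulusV modulus_natr.
by rewrite ler_pM2r ?invr_gt0 ?ltr0n // modulus_lin_direction.
Qed.

(** The loss against the limit function at [z] is the factor of
    [compound_ge_expR]. *)
Lemma extremal_at N : envelope a * (1 - growth ^+ 2 / N.+1%:R) <= modulus (extremal N z).
Proof.
rewrite extremalE !modulusM modulus_real ger0_norm ?leading_ge0 // modulus_prod.
rewrite /envelope -mulrA; apply: ler_wpM2l.
  by rewrite mulr_ge0 ?leading_ge0 // prodr_ge0 // => j _; exact: modulus_ge0.
have -> : \sum_j weight j * (a j * a j) = growth.
  by apply: eq_bigr => j _; rewrite expr2.
apply: le_trans (compound_ge_expR N growth_ge0) _.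
rewrite modulusX lin_direction_at.
have -> : 1 + growth%:C%C / N.+1%:R = (1 + growth / N.+1%:R)%:C%C :> R[i].
  by rewrite rmorphD rmorph1 fmorph_div rmorph_nat.
by rewrite modulus_real ger0_norm // addr_ge0 // divr_ge0 // growth_ge0.
Qed.

Lemma extremal_lt1 N w : unit_ball w -> modulus (extremal N w) < 1.
Proof.
move=> /unit_ballE wB; apply: le_lt_trans (extremal_le N w) _.
apply: le_lt_trans (envelope_le _) _; first by move=> j; exact: modulus_ge0.
rewrite -[ltRHS]expR0 ltr_expR pmulr_rlt0; last by rewrite divr_gt0 // ratio_gt0.
rewrite subr_lt0.
exact: wB.
Qed.

Lemma extremal_mobius N :
  mobius_competitor (@unit_ball R n) (@ball_cross R n k) (extremal N).
Proof.
split; first exact: extremal_lt1.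
  by move=> w _; exact: affine_prod_differentiable.
by move=> w [_ w0]; rewrite extremalE w0 mulr0 mul0r.
Qed.

Lemma unit_ball_coord (w : 'Cn[R]_n) j : unit_ball w -> modulus (w 0 j) <= 1.
Proof.
move=> /unit_ballE; rewrite (bigD1 j) //=.
have : 0 <= \sum_(i < n | i != j) modulus (w 0 i) ^+ 2.
  by apply: sumr_ge0 => i _; exact: sqr_ge0.
have := modulus_ge0 (w 0 j); nra.
Qed.

Lemma coord_le_enorm (w : 'Cn[R]_n) j : modulus (w 0 j) <= enorm w.
Proof.
rewrite -[leLHS]ger0_norm ?modulus_ge0 // -sqrtr_sqr ler_sqrt.
  by rewrite (bigD1 j) //= lerDl; apply: sumr_ge0 => i _; exact: sqr_ge0.
by apply: sumr_ge0 => i _; exact: sqr_ge0.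
Qed.

(** The bound [C * enorm (w - p)] comes from the coordinate of [p] that
    vanishes; the remaining coordinates are at most 1 and the exponential is
    bounded on the ball. *)
Lemma extremal_green N :
  green_competitor (@unit_ball R n) (@ball_cross R n k) (fun w => modulus (extremal N w)).
Proof.
split.
- by move=> w wB; rewrite modulus_ge0 extremal_lt1.
- exact: affine_prod_psh.
move=> p [pB /eqP]; rewrite prodf_seq_eq0 => /hasP[j _ /andP[jk /eqP pj]].
pose S := expR (\sum_j weight j * a j).
have S0 : 0 < leading * S + 1 by rewrite ltr_wpDl // mulr_ge0 ?leading_ge0 ?expR_ge0.
exists (leading * S + 1) => // w wB.
have t1 i := unit_ball_coord i wB.
apply: le_trans (extremal_le N w) _.
have prod_le : \prod_(i < n | (i < k)%N) modulus (w 0 i) <= enorm (w - p).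
  rewrite (bigD1 j) //=.
  apply: (@le_trans _ _ (modulus (w 0 j) * 1)).
    apply: ler_wpM2l; first exact: modulus_ge0.
    by apply: prodr_ile1 => i _; rewrite modulus_ge0 t1.
  have -> : w 0 j = (w - p) 0 j by rewrite !mxE pj subr0.
  by rewrite mulr1; exact: coord_le_enorm.
have e0 : 0 <= enorm (w - p) by exact: sqrtr_ge0.
have exp_le : expR (\sum_j weight j * (a j * modulus (w 0 j))) <= S.
  rewrite ler_expR; apply: ler_sum => i _; apply: ler_wpM2l; first exact: weight_ge0.
  by rewrite ler_piMr // abs_coord_ge0.
rewrite /envelope -mulrA mulrDl mul1r -[leLHS]addr0; apply: lerD => //.
rewrite -mulrA; apply: ler_wpM2l; first exact: leading_ge0.
rewrite [leRHS]mulrC; apply: ler_pM => //.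
by rewrite prodr_ge0 // => i _; exact: modulus_ge0.
Qed.
End competitor.

(** * The value of both extremal functions *)

Section sup_squeeze.
Context {R : realType}.

Lemma sup_squeeze (S : set R) (F c : R) : S !=set0 -> (forall x, S x -> x <= F) ->
  (forall N : nat, exists2 x, S x & F * (1 - c / N.+1%:R) <= x) -> sup S = F.
Proof.
move=> S0 SF low; have hub : has_ubound S by exists F => x /SF.
apply/eqP; rewrite eq_le ge_sup //=; apply/ler_addgt0Pr => e e0.
pose N := Num.truncn (F * c / e); have [x Sx xF] := low N.
have xs : x <= sup S by exact: ub_le_sup.
have M0 : 0 < N.+1%:R :> R by rewrite ltr0n.
have : F * c / N.+1%:R <= e.
  by rewrite ler_pdivrMr // [leRHS]mulrC -ler_pdivrMr // ltW // truncnS_gt.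
move: xF; rewrite mulrBr mulr1 mulrA lerBlDr => xF Fe.
exact: le_trans xF (lerD xs Fe).
Qed.
End sup_squeeze.

Theorem corollary1p4 (R : realType) (n k : nat) (z : 'Cn[R]_n)
    (hn : (2 <= n)%N) (hk : (1 <= k <= n)%N)
    (hz : unit_ball z)
    (hord : forall i j : 'I_n, (i <= j)%N -> (j < k)%N ->
       modulus (z 0 i) <= modulus (z 0 j)) :
  let d := cross_index k z in
  mobius (@unit_ball R n) (@ball_cross R n k) z
    = green (@unit_ball R n) (@ball_cross R n k) z
  /\ green (@unit_ball R n) (@ball_cross R n k) z
    = (d%:R / (1 - \sum_(j < n | (d <= j)%N) modulus (z 0 j) ^+ 2))
        `^ (d%:R / 2)
      * \prod_(j < n | (j < d)%N) modulus (z 0 j).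
Proof.
move=> d; have dk : (0 < d <= k)%N := cross_index_bounds hk hz.
have kn : (k <= n)%N by case/andP: hk.
have d0 : (0 < d)%N by case/andP: dk.
have dlek : (d <= k)%N by case/andP: dk.
rewrite -/(tail_gap d z); set b := tail_gap d z.
have b0 : 0 < b := tail_gap_gt0 d hz.
have above := cross_index_above hord : forall j : 'I_n, (d <= j)%N -> (j < k)%N ->
  b < d%:R * modulus (z 0 j) ^+ 2.
have below := cross_index_below hk hz hord.
have bE : b = tail_gap d z by [].
have c0 : 0 < d%:R / b by rewrite divr_gt0 // ltr0n.
pose r := Num.sqrt (d%:R / b).
have r0 : 0 < r by rewrite sqrtr_gt0.
have r2 : r ^+ 2 = d%:R / b by rewrite sqr_sqrtr // ltW.
pose F := \prod_(j < n | (j < d)%N) (modulus (z 0 j) * r).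
have FE : F = (d%:R / b) `^ (d%:R / 2) * \prod_(j < n | (j < d)%N) modulus (z 0 j).
  rewrite /F big_split /= mulrC; congr (_ * _).
  have dn : (d <= n)%N by exact: leq_trans kn.
  rewrite -(big_ord_widen n (fun=> r) dn) prodr_const card_ord.
  rewrite [d%:R / 2]mulrC powRrM powR12_sqrt; last exact: ltW.
  by rewrite powR_mulrn // ltW.
have rV0 : 0 < r^-1 by rewrite invr_gt0.
have drho : d%:R * r^-1 ^+ 2 = tail_gap d z.
  rewrite exprVn r2 -/b; field; rewrite gt_eqF //=.
  by rewrite pnatr_eq0 -lt0n.
have zr (j : 'I_n) : (j < d)%N -> modulus (z 0 j) <= r^-1.
  move=> jd; rewrite -(@ler_pXn2r _ 2) ?nnegrE ?modulus_ge0 ?(ltW rV0) //.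
  rewrite -(ler_pM2l (_ : 0 < d%:R)) ?ltr0n // drho; exact: below.
have u_le_F (u : 'Cn[R]_n -> R) : coord_schwarz k u -> (forall w, unit_ball w
  -> u w <= 1) ->
    u z <= F.
  move=> us u1; have := coord_schwarz_bound us _ rV0 drho u1 hz zr.
  by under eq_bigr do rewrite invrK; apply; rewrite dlek.
have lower := extremal_at dk b0 above.
have FA : envelope k d z b (fun j => modulus (z 0 j)) = F by exact: envelope_at
  dk b0 above.
have mobF : mobius (@unit_ball R n) (@ball_cross R n k) z = F.
  apply: (@sup_squeeze _ _ F (growth k d z b ^+ 2)).
  - by exists (modulus (extremal k d z b 0 z));
    exists (extremal k d z b 0) => //; exact: extremal_mobius.
  - move=> _ [f fc <-]; apply: (u_le_F (fun w => modulus (f w))).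
      exact: mobius_coord_schwarz fc.
    by move=> w wB; case: fc => f1 _ _; exact/ltW/f1.
  - move=> N; exists (modulus (extremal k d z b N z)); last by rewrite -FA.
    by exists (extremal k d z b N) => //; exact: extremal_mobius.
have greenF : green (@unit_ball R n) (@ball_cross R n k) z = F.
  apply: (@sup_squeeze _ _ F (growth k d z b ^+ 2)).
  - by exists (modulus (extremal k d z b 0 z));
    exists (fun w => modulus (extremal k d z b 0 w)) => //; exact: extremal_green.
  - move=> _ [u uc <-]; apply: u_le_F; first exact: green_coord_schwarz uc.
    by move=> w wB; case: uc => u1 _ _; case/andP: (u1 w wB) => _ /ltW.
  - move=> N; exists (modulus (extremal k d z b N z)); last by rewrite -FA.
    by exists (fun w => modulus (extremal k d z b N w)) => //; exact: extremal_green.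
by rewrite mobF greenF FE.
Qed.
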